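(* For any $\varepsilon,r>0$ there exists $c>0$ such that the following holds for every finite set $A$ and every $n\in\mathbb{N}$. Let $\mu\in\Pr(A^n)$, let $\mu_{\{i\}}\in\Pr(A)$ be its marginals for $i=1,\dots,n$, and set $E:=\sum_{i=1}^n\mathrm{H}(\mu_{\{i\}})-\mathrm{H}(\mu)$. Then $\mu$ may be written as a mixture $\mu=p_1\mu_1+\dots+p_m\mu_m$ (with $p_j\ge0$, $\sum_jp_j=1$, $\mu_j\in\Pr(A^n)$) so that (a) $m\le c\,e^{cE}$; (b) $p_1<\varepsilon$; and (c) the measure $\mu_j$ satisfies $\mathrm{T}(rn/1200,r)$ for every $j=2,3,\dots,m$.
   Context: $\Pr(A^n)$ is the set of probability measures on $A^n$; $\mathrm{H}$ is Shannon entropy (natural logarithm). $A^n$ carries the normalized Hamming metric $d_n(\mathbf a,\mathbf a')=|\{i:a_i\ne a_i'\}|/n$, and $\overline{d_n}$ is the associated transportation metric on $\Pr(A^n)$: $\overline{d_n}(\mu,\nu)=\inf\{\int d_n\,d\lambda:\lambda \text{ a coupling of }\mu,\nu\}$. $\mathrm{D}(\nu\|\mu)$ denotes Kullback--Leibler divergence. For $\kappa,r>0$, a measure $\mu$ on a compact metric space $(K,d)$ satisfies $\mathrm{T}(\kappa,r)$ if every $\nu\in\Pr(K)$ satisfies $\overline{d}(\nu,\mu)\le \frac1\kappa\mathrm{D}(\nu\|\mu)+r$. *)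

(* Defs.v *)
From HB Require Import structures.
From mathcomp Require Import all_boot all_order all_algebra.
From mathcomp Require Import all_classical all_reals all_analysis.
Set Implicit Arguments.
Unset Strict Implicit.
Unset Printing Implicit Defensive.
Import Order.TTheory GRing.Theory Num.Theory.
Local Open Scope ring_scope.
Local Open Scope classical_set_scope.

Section Defs.
Variable R : realType.

Definition is_prob (T : finType) (mu : {ffun T -> R}) : Prop :=
  (forall x, 0 <= mu x) /\ \sum_(x : T) mu x = 1.

(* Shannon entropy, natural logarithm (0 ln 0 = 0 since the term is multiplied by 0). *)
Definition entropy (T : finType) (mu : {ffun T -> R}) : R :=
  - \sum_(x : T) mu x * ln (mu x).

Definition marginal (A : finType) (n : nat) (mu : {ffun {ffun 'I_n -> A} -> R})
  (i : 'I_n) : {ffun A -> R} :=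
  [ffun a => \sum_(x : {ffun 'I_n -> A} | x i == a) mu x].

Definition hamming (A : finType) (n : nat) (x y : {ffun 'I_n -> A}) : R :=
  (#|[set i | x i != y i]|)%:R / n%:R.

Definition coupling (T : finType) (mu nu : {ffun T -> R}) (lam : {ffun T * T -> R}) : Prop :=
  (forall z, 0 <= lam z) /\
  (forall x, \sum_(y : T) lam (x, y) = mu x) /\
  (forall y, \sum_(x : T) lam (x, y) = nu y).

Definition transport (T : finType) (d : T -> T -> R) (mu nu : {ffun T -> R}) : R :=
  inf [set c | exists lam, coupling mu nu lam /\ c = \sum_(z : T * T) d z.1 z.2 * lam z].

Definition KL (T : finType) (nu mu : {ffun T -> R}) : \bar R :=
  if [forall x, (mu x == 0) ==> (nu x == 0)]
  then (\sum_(x : T) nu x * ln (nu x / mu x))%:E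
  else +oo%E.

Definition Tineq (T : finType) (d : T -> T -> R) (kappa r : R) (mu : {ffun T -> R}) : Prop :=
  forall nu : {ffun T -> R}, is_prob nu ->
    ((transport d nu mu)%:E <= (kappa^-1)%:E * KL nu mu + r%:E)%E.

End Defs.

(* Main.v *)
(* Let tc(q) = sum_i H(xi_i) - H(xi) and dtc(q) = H(xi) - sum_i H(xi_i | xi_j, j != i).

   It suffices to show that every theta <= mu / eps admits a measure nu satisfying T with
   nu <= C exp(C E) theta: such pieces are then split off mu until the rest has mass
   < eps. Since theta <= mu / eps, tc(theta) = O(E + 1).

   Discarding O(r n) coordinates makes dtc at most O((tc + 1) / r): a coordinate is
   discarded as long as this lowers tc by much. Let m minimize dtc(q) + D(q || theta) / 2.
   As dtc >= 0, D(m || theta) <= 2 dtc(theta), so truncating the density of m costs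
   little. Since D(.|| m) and the conditional divergences D_i given the coordinates
   other than i are the second-order parts of the functional, optimality of m gives
   D(q || m) / 2 <= sum_i D_i(q || m). Hence some coordinate can be resampled with a
   relative decrease 1 / (2 n) of the divergence, and iterating these moves transports q
   to m at cost at most sqrt (8 D(q || m) / n) <= D(q || m) / kappa + 2 kappa / n. *)

Require Import Defs.
From HB Require Import structures.
From mathcomp Require Import all_boot all_order all_algebra.
From mathcomp Require Import all_classical all_reals all_analysis.
From mathcomp Require Import lra ring.
Set Implicit Arguments.
Unset Strict Implicit.
Unset Printing Implicit Defensive.
Import Order.TTheory GRing.Theory Num.Theory.
Local Open Scope ring_scope.

(** * Relative entropy *)

Section Divergence.
Context {R : realType} {X : finType}.
Implicit Types p q : X -> R.

Definition prob p := (forall x, 0 <= p x) /\ \sum_x p x = 1.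

Definition dominated q p := forall x, p x = 0 -> q x = 0.

Definition rel_ent q p : R := \sum_x q x * ln (q x / p x).

Lemma ln_le_sub1 (t : R) : 0 < t -> ln t <= t - 1.
Proof.
move=> t0; have := @le_ln1Dx R (t - 1).
by rewrite (addrC 1) subrK; apply; lra.
Qed.

(** This is [ln t <= t - 1] at [t = b / a]. The implication excludes [b = 0 < a], where [a / 0] and
    [ln 0] would take the default value 0. *)
Lemma mul_ln_ratio_ge (a b : R) : 0 <= a -> 0 <= b -> (b = 0 -> a = 0) ->
  a - b <= a * ln (a / b).
Proof.
move=> a0 b0 ab; have [->|an0] := eqVneq a 0; first by rewrite mul0r sub0r oppr_le0.
have apos : 0 < a by rewrite lt_def an0.
have bpos : 0 < b.
  by rewrite lt_def b0 andbT; apply/eqP => /ab /eqP; rewrite (negPf an0).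
have /(ler_wpM2l a0) : ln (b / a) <= b / a - 1 by apply: ln_le_sub1; rewrite divr_gt0.
rewrite mulrBr mulrCA divff// !mulr1 !ln_div ?posrE// !mulrBr; lra.
Qed.

Lemma rel_ent_ge q p : (forall x, 0 <= q x) -> (forall x, 0 <= p x) ->
  dominated q p -> \sum_x q x - \sum_x p x <= rel_ent q p.
Proof.
move=> q0 p0 qp; rewrite -sumrB; apply: ler_sum => x _.
exact: mul_ln_ratio_ge (qp x).
Qed.

Lemma rel_ent_ge0 q p : prob q -> prob p -> dominated q p -> 0 <= rel_ent q p.
Proof.
by move=> [q0 q1] [p0 p1] /(rel_ent_ge q0 p0); rewrite q1 p1 subrr.
Qed.

(** Where the logarithm is negative, [q ln (q / p) >= q - p >= - p], so the negative part totals at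
    most the mass of [p]. A divergence bound thereby controls large densities. *)
Lemma rel_ent_pos_part q p : (forall x, 0 <= q x) -> (forall x, 0 <= p x) ->
  dominated q p ->
  \sum_x q x * Num.max 0 (ln (q x / p x)) <= rel_ent q p + \sum_x p x.
Proof.
move=> q0 p0 qp; rewrite -big_split; apply: ler_sum => x _ /=.
rewrite maxEle; case: ifP => _; first by rewrite lerDl.
have := mul_ln_ratio_ge (q0 x) (p0 x) (qp x); have := q0 x; lra.
Qed.

Lemma mul_ln_ratio_le (a b : R) : 0 <= a -> 0 <= b -> (b = 0 -> a = 0) ->
  a * ln (a / b) <= (a - b) + (a - b) ^+ 2 / b.
Proof.
move=> a0 b0 ab; have [->|an0] := eqVneq a 0.
  rewrite mul0r sub0r sqrrN; have [->|bn0] := eqVneq b 0.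
    by rewrite expr0n mul0r oppr0 addr0.
  by rewrite expr2 mulfK// addNr.
have apos : 0 < a by rewrite lt_def an0.
have bpos : 0 < b.
  by rewrite lt_def b0 andbT; apply/eqP => /ab /eqP; rewrite (negPf an0).
have /(ler_wpM2l a0) h : ln (a / b) <= a / b - 1 by apply: ln_le_sub1; rewrite divr_gt0.
apply: (le_trans h); rewrite le_eqVlt; apply/orP; left; apply/eqP; field.
by rewrite gt_eqF.
Qed.

(** The first-order terms [q - p] sum to 0, so near [p] the divergence is of second order; the
    optimality argument rests on this. *)
Lemma rel_ent_le_chi2 q p : prob q -> prob p -> dominated q p ->
  rel_ent q p <= \sum_x (q x - p x) ^+ 2 / p x.
Proof.
move=> [q0 q1] [p0 p1] qp.
have -> : \sum_x (q x - p x) ^+ 2 / p x =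
    \sum_x ((q x - p x) + (q x - p x) ^+ 2 / p x).
  by rewrite big_split /= sumrB q1 p1 subrr add0r.
by apply: ler_sum => x _; exact: mul_ln_ratio_le (qp x).
Qed.

Definition tvar q p : R := (\sum_x `|q x - p x|) / 2.

(** With [s], [t] the roots of [a], [b], multiply [ln (t / s) <= t / s - 1] by [2 s ^ 2]. Summed,
    the squared Hellinger distance is at most the divergence. *)
Lemma hellinger_le (a b : R) : 0 <= a -> 0 <= b -> (b = 0 -> a = 0) ->
  (Num.sqrt a - Num.sqrt b) ^+ 2 <= a * ln (a / b) - (a - b).
Proof.
move=> a0 b0 ab; have [->|an0] := eqVneq a 0.
  by rewrite sqrtr0 !sub0r sqrrN mul0r add0r opprK sqr_sqrtr.
have apos : 0 < a by rewrite lt_def an0.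
have bpos : 0 < b.
  by rewrite lt_def b0 andbT; apply/eqP => /ab /eqP; rewrite (negPf an0).
set s := Num.sqrt a; set t := Num.sqrt b.
have s0 : 0 < s by rewrite sqrtr_gt0.
have t0 : 0 < t by rewrite sqrtr_gt0.
have -> : a = s ^+ 2 by rewrite sqr_sqrtr.
have -> : b = t ^+ 2 by rewrite sqr_sqrtr.
have h : ln (t / s) <= t / s - 1 by apply: ln_le_sub1; rewrite divr_gt0.
rewrite -expr_div_n lnXn ?divr_gt0// ln_div ?posrE//.
rewrite ln_div ?posrE// in h.
have /(ler_wpM2l (ltW (exprn_gt0 2 s0))) := h.
have -> : s ^+ 2 * (t / s - 1) = s * t - s ^+ 2.
  by rewrite mulrBr mulr1 expr2 -mulrA (mulrCA s t) divff ?gt_eqF// mulr1.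
rewrite !mulrBr -mulr_natr; nra.
Qed.

(** A Pinsker-type inequality through the Hellinger distance: [|q - p|] factors as [|s - t| (s + t)]
    over the roots, and Young's inequality with weight [u] splits the product. *)
Lemma tvar_le_sqrt_rel_ent q p : prob q -> prob p -> dominated q p ->
  tvar q p <= Num.sqrt (rel_ent q p).
Proof.
move=> Pq Pp qp; have D0 := rel_ent_ge0 Pq Pp qp.
case: Pq Pp => q0 q1 [p0 p1].
(* The best weight is [u = 1 / sqrt D]; when [D = 0], [u] is taken arbitrarily large. *)
suff key (u : R) : 0 < u -> tvar q p <= u / 2 * rel_ent q p + u^-1 / 2.
  have [D00|Dn0] := eqVneq (rel_ent q p) 0.
    rewrite D00 sqrtr0; apply/ler_addgt0Pr => z z0; rewrite add0r.
    have := key z^-1; rewrite invr_gt0 D00 mulr0 add0r invrK => /(_ z0).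
    by move=> h; apply: (le_trans h); lra.
  have Dpos : 0 < rel_ent q p by rewrite lt_def Dn0.
  set s := Num.sqrt _; have s0 : 0 < s by rewrite sqrtr_gt0.
  have := key s^-1; rewrite invr_gt0 invrK => /(_ s0) h; apply: (le_trans h).
  have -> : rel_ent q p = s ^+ 2 by rewrite sqr_sqrtr.
  have -> : s^-1 / 2 * s ^+ 2 = s / 2 by field; rewrite gt_eqF.
  lra.
move=> u0.
have hsum : \sum_x (Num.sqrt (q x) - Num.sqrt (p x)) ^+ 2 <= rel_ent q p.
  have -> : rel_ent q p = \sum_x (q x * ln (q x / p x) - (q x - p x)).
    by rewrite sumrB sumrB q1 p1 subrr subr0.
  by apply: ler_sum => x _; exact: hellinger_le (qp x).
have : \sum_x `|q x - p x| <=
  \sum_x (u * (Num.sqrt (q x) - Num.sqrt (p x)) ^+ 2 + u^-1 * ((q x + p x) / 2)).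
  apply: ler_sum => x _; set s := Num.sqrt (q x); set t := Num.sqrt (p x).
  have s0 : 0 <= s by rewrite sqrtr_ge0.
  have t0 : 0 <= t by rewrite sqrtr_ge0.
  have -> : q x = s ^+ 2 by rewrite sqr_sqrtr.
  have -> : p x = t ^+ 2 by rewrite sqr_sqrtr.
  rewrite subr_sqr normrM (ger0_norm (addr_ge0 s0 t0)).
  set w := `|s - t|; have w2 : w ^+ 2 = (s - t) ^+ 2 by rewrite real_normK// num_real.
  rewrite -w2; have w0 : 0 <= w by exact: normr_ge0.
  have uV : u * u^-1 = 1 by rewrite divff// gt_eqF.
  have uV0 : 0 < u^-1 by rewrite invr_gt0.
  apply: (@le_trans _ _ (u * w ^+ 2 + u^-1 * ((s + t) ^+ 2 / 4))).
    have := sqr_ge0 (u * w - (s + t) / 2).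
    move=> /(mulr_ge0 (ltW uV0)).
    have -> : u^-1 * (u * w - (s + t) / 2) ^+ 2 =
      u * w ^+ 2 + u^-1 * ((s + t) ^+ 2 / 4) - w * (s + t).
      by field; rewrite gt_eqF.
    by rewrite subr_ge0.
  rewrite lerD2l; apply: ler_wpM2l; first exact: ltW.
  have := sqr_ge0 (s - t); rewrite sqrrB sqrrD; lra.
rewrite big_split /= -!mulr_sumr -mulr_suml big_split /= q1 p1.
rewrite /tvar => h.
have := ler_wpM2l (ltW u0) hsum; lra.
Qed.

End Divergence.

(** * Push-forwards and resampling *)

Section Pushforward.
Context {R : realType} {X Y : finType}.
Variable g : X -> Y.
Implicit Types p q : X -> R.

Definition push q (y : Y) : R := \sum_(x | g x == y) q x.

Lemma sum_push q (f : Y -> R) : \sum_y push q y * f y = \sum_x q x * f (g x).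
Proof.
rewrite [RHS](partition_big g xpredT)//=; apply: eq_bigr => y _.
by rewrite /push mulr_suml; apply: eq_bigr => x /eqP ->.
Qed.

Lemma sum_push1 q : \sum_y push q y = \sum_x q x.
Proof. by rewrite [RHS](partition_big g xpredT). Qed.

Lemma push_mulr q (f : Y -> R) y : push (fun x => q x * f (g x)) y = push q y * f y.
Proof. by rewrite /push mulr_suml; apply: eq_bigr => x /eqP ->. Qed.

Lemma push_ge0 q : (forall x, 0 <= q x) -> forall y, 0 <= push q y.
Proof. by move=> q0 y; apply: sumr_ge0. Qed.

Lemma le_push q : (forall x, 0 <= q x) -> forall x, q x <= push q (g x).
Proof.
move=> q0 x; rewrite /push (bigD1 x)//= lerDl; exact: sumr_ge0.
Qed.

Lemma push_gt0 q : (forall x, 0 <= q x) -> forall x, 0 < q x -> 0 < push q (g x).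
Proof. by move=> q0 x /lt_le_trans; apply; exact: le_push. Qed.

Lemma prob_push q : prob q -> prob (push q).
Proof. by move=> [q0 q1]; split; [exact: push_ge0|rewrite sum_push1]. Qed.

Lemma dominated_push q p : (forall x, 0 <= p x) -> dominated q p ->
  dominated (push q) (push p).
Proof.
move=> p0 qp y /eqP; rewrite psumr_eq0// => /allP py.
rewrite /push big1// => x /eqP gx; apply: qp.
by apply/eqP; have := py x; rewrite mem_index_enum gx eqxx/= => /(_ isT).
Qed.

(** Keeps the law of [g] under [q] and takes the conditional law of [p] on each fiber of [g]. *)
Definition resample q p x : R := p x * (push q (g x) / push p (g x)).

Section Resample.
Variables p q : X -> R.
Hypotheses (p0 : forall x, 0 <= p x) (q0 : forall x, 0 <= q x).
Hypothesis qp : dominated q p.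

Lemma resample_ge0 x : 0 <= resample q p x.
Proof. by rewrite mulr_ge0// divr_ge0// push_ge0. Qed.

Lemma push_resample y : push (resample q p) y = push q y.
Proof.
rewrite (push_mulr p (fun y => push q y / push p y)).
have [P0|Pn0] := eqVneq (push p y) 0.
  by rewrite P0 mul0r (dominated_push p0 qp P0).
by rewrite mulrC divfK.
Qed.

Lemma dominated_resample : dominated (resample q p) p.
Proof. by move=> x; rewrite /resample => ->; rewrite mul0r. Qed.

Lemma gt0_dominated x : 0 < q x -> 0 < p x.
Proof.
move=> qx; rewrite lt_def p0 andbT; apply/eqP => /qp qx0.
by rewrite qx0 ltxx in qx.
Qed.

Lemma resample_gt0 x : 0 < q x -> 0 < resample q p x.
Proof.
move=> qx; have px := gt0_dominated qx.
by rewrite mulr_gt0// divr_gt0// push_gt0.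
Qed.

Lemma dominated_by_resample : dominated q (resample q p).
Proof.
move=> x rx; apply/eqP; apply: contraT => qx.
have /resample_gt0 : 0 < q x by rewrite lt_def qx q0.
by rewrite rx ltxx.
Qed.

Lemma rel_ent_resample : rel_ent (resample q p) p = rel_ent (push q) (push p).
Proof.
rewrite /rel_ent.
transitivity (\sum_y push (resample q p) y * ln (push q y / push p y)).
  rewrite (sum_push _ (fun y => ln (push q y / push p y))); apply: eq_bigr => x _.
  have [px|px] := eqVneq (p x) 0; first by rewrite /resample px !mul0r.
  by rewrite {2}/resample [p x * _]mulrC mulfK.
by apply: eq_bigr => y _; rewrite push_resample.
Qed.

(** Chain rule: on the support of [q], the density of [q] against [resample q p] is [q / p] divided
    by the density of the push-forwards. *)
Lemma rel_ent_by_resample :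
  rel_ent q (resample q p) = rel_ent q p - rel_ent (push q) (push p).
Proof.
rewrite /rel_ent (sum_push q (fun y => ln (push q y / push p y))) -sumrB.
apply: eq_bigr => x _; have [->|qn0] := eqVneq (q x) 0; first by rewrite !mul0r subrr.
have qx : 0 < q x by rewrite lt_def qn0 q0.
have px := gt0_dominated qx.
have Qx := push_gt0 q0 qx; have Px := push_gt0 p0 px.
rewrite -mulrBr /resample !ln_div ?posrE ?mulr_gt0 ?invr_gt0//.
by rewrite lnM ?posrE ?divr_gt0// ln_div ?posrE//; congr (_ * _); lra.
Qed.

End Resample.

Lemma prob_resample q p : prob q -> prob p -> dominated q p -> prob (resample q p).
Proof.
move=> [q0 q1] [p0 p1] qp; split; first exact: resample_ge0.
rewrite -sum_push1; under eq_bigr do rewrite push_resample//.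
by rewrite sum_push1.
Qed.

(** Data processing: by the chain rule the difference is itself a divergence. *)
Lemma rel_ent_push_le q p : prob q -> prob p -> dominated q p ->
  rel_ent (push q) (push p) <= rel_ent q p.
Proof.
move=> Pq Pp qp; have [q0 _] := Pq; have [p0 _] := Pp.
rewrite -subr_ge0 -rel_ent_by_resample//; apply: rel_ent_ge0 => //.
  exact: prob_resample.
exact: dominated_by_resample.
Qed.

(** The conditional divergence given [g]; it is [D_i] when [g] forgets the i-th coordinate. *)
Definition fiber_drop q p : R := rel_ent q p - rel_ent (push q) (push p).

End Pushforward.

Lemma push_comp (R : realType) (Z Y W : finType) (g : Z -> Y) (f : Y -> W) (q : Z -> R) :
  push f (push g q) = push (f \o g) q.
Proof.
apply/funext => w; rewrite /push [RHS](partition_big g (fun y => f y == w))//=.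
apply: eq_bigr => y fy; apply: eq_bigl => x; apply/idP/andP => [/eqP gx|[] //].
by split; rewrite /= gx.
Qed.

(** * Couplings *)

Section Couplings.
Context {R : realType} {X : finType}.
Variable d : X -> X -> R.
Implicit Types p q : X -> R.

(** A bound on the cost rather than an infimum, so that couplings compose without an optimal one. *)
Definition coupled q p (c : R) := exists lam : X -> X -> R,
  [/\ forall x y, 0 <= lam x y, forall x, \sum_y lam x y = q x,
      forall y, \sum_x lam x y = p y & \sum_x \sum_y d x y * lam x y <= c].

Lemma coupled_le q p c c' : c <= c' -> coupled q p c -> coupled q p c'.
Proof.
by move=> cc' [lam [? ? ? h]]; exists lam; split => //; exact: le_trans cc'.
Qed.

Lemma coupled_sym q p c : (forall x y, d x y = d y x) ->
  coupled q p c -> coupled p q c.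
Proof.
move=> ds [lam [l0 l1 l2 h]]; exists (fun x y => lam y x); split => //.
rewrite exchange_big /=; apply: le_trans h; rewrite le_eqVlt; apply/orP; left.
by apply/eqP; apply: eq_bigr => x _; apply: eq_bigr => y _; rewrite ds.
Qed.

(** Gluing: the end points are made conditionally independent given the middle one. Where [p y = 0]
    both couplings vanish, so the default value of the quotient is correct. *)
Lemma coupled_trans q p s c c' :
  (forall x y z, d x z <= d x y + d y z) ->
  coupled q p c -> coupled p s c' -> coupled q s (c + c').
Proof.
move=> dt [l [l0 lq lp lc]] [k [k0 kp ks kc]].
have l00 x y : p y = 0 -> l x y = 0.
  rewrite -lp => /eqP; rewrite psumr_eq0// => /allP/(_ x).
  by rewrite mem_index_enum => /(_ isT)/eqP.
have k00 y z : p y = 0 -> k y z = 0.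
  rewrite -kp => /eqP; rewrite psumr_eq0// => /allP/(_ z).
  by rewrite mem_index_enum => /(_ isT)/eqP.
have p0 y : 0 <= p y by rewrite -lp sumr_ge0.
have rowE x y : \sum_z l x y * k y z / p y = l x y.
  rewrite -mulr_suml -mulr_sumr kp; have [p00|pn0] := eqVneq (p y) 0.
    by rewrite p00 l00// !mul0r.
  by rewrite mulfK.
have colE y z : \sum_x l x y * k y z / p y = k y z.
  rewrite -mulr_suml -mulr_suml lp; have [p00|pn0] := eqVneq (p y) 0.
    by rewrite p00 k00// !mul0r.
  by rewrite mulrC mulKf.
exists (fun x z => \sum_y l x y * k y z / p y); split.
- by move=> x z; apply: sumr_ge0 => y _; rewrite divr_ge0// mulr_ge0.
- by move=> x; rewrite exchange_big /= -lq; apply: eq_bigr => y _; exact: rowE.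
- by move=> z; rewrite exchange_big /= -ks; apply: eq_bigr => y _; exact: colE.
apply: (@le_trans _ _ (\sum_x \sum_z \sum_y
    (d x y * (l x y * k y z / p y) + d y z * (l x y * k y z / p y)))).
  apply: ler_sum => x _; apply: ler_sum => z _; rewrite mulr_sumr.
  apply: ler_sum => y _; rewrite -mulrDl ler_wpM2r//.
  by rewrite divr_ge0// mulr_ge0.
have -> : \sum_x \sum_z \sum_y
    (d x y * (l x y * k y z / p y) + d y z * (l x y * k y z / p y)) =
  \sum_x \sum_y d x y * l x y + \sum_y \sum_z d y z * k y z.
  under eq_bigr do under eq_bigr do rewrite big_split.
  under eq_bigr do rewrite big_split.
  rewrite big_split /=; congr (_ + _).
    apply: eq_bigr => x _; rewrite exchange_big /=; apply: eq_bigr => y _.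
    by rewrite -mulr_sumr rowE.
  rewrite exchange_big /=; under eq_bigr do rewrite exchange_big /=.
  rewrite exchange_big /=; apply: eq_bigr => y _; apply: eq_bigr => z _.
  by rewrite -mulr_sumr colE.
exact: lerD.
Qed.

(* Common mass stays put; the excess [(q - p)^+] is matched with [(p - q)^+]
   independently inside each fiber. *)
Lemma coupled_fiber (Y : finType) (g : X -> Y) q p c :
  (forall x, 0 <= q x) -> (forall x, 0 <= p x) -> (forall y, push g q y = push g p y) ->
  (forall x, d x x = 0) -> (forall x y, g x = g y -> d x y <= c) ->
  coupled q p (c * tvar q p).
Proof.
move=> q0 p0 qp dxx dc.
(* [u], [v] and [w] are [(q - p)^+], [(p - q)^+] and [min q p]. *)
pose u x := (`|q x - p x| + (q x - p x)) / 2.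
pose v x := (`|q x - p x| - (q x - p x)) / 2.
pose w x := (q x + p x - `|q x - p x|) / 2.
have u0 x : 0 <= u x.
  by rewrite divr_ge0// -lerBlDr sub0r -normrN ler_norm.
have v0 x : 0 <= v x by rewrite divr_ge0// subr_ge0 ler_norm.
have w0 x : 0 <= w x.
  rewrite divr_ge0// subr_ge0 (le_trans (ler_normB _ _))//.
  by rewrite !ger0_norm.
have uv y : push g u y = push g v y.
  apply/eqP; rewrite -subr_eq0 /push -sumrB; apply/eqP.
  have h : \sum_(x | g x == y) (q x - p x) = 0.
    by apply/eqP; rewrite sumrB subr_eq0; apply/eqP; exact: qp.
  rewrite -[RHS]h.
  by apply: eq_bigr => x _; rewrite /u /v; lra.
have wu x : w x + u x = q x by rewrite /w /u; lra.
have wv x : w x + v x = p x by rewrite /w /v; lra.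
pose D x y := if x == y then w x else 0.
pose K x y := if g y == g x then u x * v y / push g u (g x) else 0.
have K0 x y : 0 <= K x y.
  rewrite /K; case: ifP => // _; apply: divr_ge0; first exact: mulr_ge0.
  exact: push_ge0.
have Kr x : \sum_y K x y = u x.
  rewrite -big_mkcond /= -mulr_suml -mulr_sumr.
  rewrite -/(push g v (g x)) -uv; have [U0|Un0] := eqVneq (push g u (g x)) 0.
    rewrite U0 mulr0 mul0r; apply/esym/eqP; rewrite eq_le u0 andbT.
    by rewrite -U0; exact: le_push.
  by rewrite mulfK.
have Kc y : \sum_x K x y = v y.
  rewrite -big_mkcond /=.
  transitivity (\sum_(x | g x == g y) u x * (v y / push g u (g y))).
    by apply: eq_big => [x|x /eqP ->]; [rewrite eq_sym|rewrite mulrA].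
  rewrite -mulr_suml -/(push g u (g y)).
  have [U0|Un0] := eqVneq (push g u (g y)) 0.
    rewrite U0 mul0r; apply/esym/eqP; rewrite eq_le v0 andbT.
    by rewrite -U0 uv; exact: le_push.
  by rewrite mulrC divfK.
exists (fun x y => D x y + K x y); split.
- by move=> x y; rewrite addr_ge0// /D; case: ifP.
- move=> x; rewrite big_split /= Kr -big_mkcond /=.
  by rewrite (big_pred1 x) ?wu// => y; rewrite eq_sym.
- by move=> y; rewrite big_split /= Kc -big_mkcond /= big_pred1_eq wv.
apply: (@le_trans _ _ (\sum_x \sum_y c * K x y)).
  apply: ler_sum => x _; apply: ler_sum => y _; rewrite mulrDr.
  have -> : d x y * D x y = 0.
    by rewrite /D; case: eqP => [->|_]; rewrite ?dxx ?mul0r ?mulr0.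
  rewrite add0r /K; case: eqP => [gxy|_]; last by rewrite !mulr0.
  apply: ler_wpM2r; last exact: dc.
  by apply: divr_ge0; [exact: mulr_ge0|exact: push_ge0].
under eq_bigr do rewrite -mulr_sumr Kr.
rewrite -mulr_sumr -mulr_suml /tvar big_split /=.
have -> : \sum_x (q x - p x) = 0; last by rewrite addr0.
by rewrite sumrB -(sum_push1 g q) -(sum_push1 g p) (eq_bigr _ (fun y _ => qp y)) subrr.
Qed.

Lemma coupled_tvar q p c : prob q -> prob p ->
  (forall x, d x x = 0) -> (forall x y, d x y <= c) -> coupled q p (c * tvar q p).
Proof.
move=> [q0 q1] [p0 p1] dxx dc.
apply: (@coupled_fiber _ (fun=> tt)) => // -[].
have E (f : X -> R) : push (fun=> tt) f tt = \sum_x f x by apply: eq_bigl.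
by rewrite !E q1 p1.
Qed.

Lemma coupled_push (f : X -> X) q c : prob q -> (forall x, d x (f x) <= c) ->
  coupled q (push f q) c.
Proof.
move=> [q0 q1] dc; exists (fun x y => if y == f x then q x else 0); split.
- by move=> x y; case: ifP.
- by move=> x; rewrite -big_mkcond /= big_pred1_eq.
- by move=> y; rewrite -big_mkcond /=; apply: eq_bigl => x; rewrite eq_sym.
apply: (@le_trans _ _ (\sum_x c * q x)); last by rewrite -mulr_sumr q1 mulr1.
apply: ler_sum => x _; rewrite (bigD1 (f x))//= eqxx big1 ?addr0.
  by rewrite ler_wpM2r.
by move=> y /negPf ->; rewrite mulr0.
Qed.

End Couplings.

(** * Transport inequality from tensorization of entropy *)

Section TensorizationTransport.
Import numFieldNormedType.Exports.
Context {R : realType} {X Y : finType} {n : nat}.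
Variables (g : 'I_n.+1 -> X -> Y) (d : X -> X -> R) (m : X -> R).
Implicit Types q : X -> R.

Let N : R := n.+1%:R.

Hypotheses (dxx : forall x, d x x = 0) (d1 : forall x y, d x y <= 1).
Hypothesis dtri : forall x y z, d x z <= d x y + d y z.
Hypothesis dg : forall i x y, g i x = g i y -> d x y <= N^-1.

Hypothesis mP : prob m.
Hypothesis tensorization : forall q, prob q -> dominated q m ->
  rel_ent q m / 2 <= \sum_i fiber_drop (g i) q m.

Let N0 : 0 < N. Proof. by rewrite ltr0n. Qed.

Lemma exists_fiber_drop q : prob q -> dominated q m ->
  exists i, rel_ent q m / (2 * N) <= fiber_drop (g i) q m.
Proof.
move=> qP qm; apply: contrapT => /forallNP h.
have : \sum_i fiber_drop (g i) q m < \sum_(i < n.+1) rel_ent q m / (2 * N).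
  apply: ltr_sum; first by apply/hasP; exists ord0; rewrite ?mem_index_enum.
  by move=> i _; rewrite ltNge; apply/negP/h.
rewrite sumr_const card_ord -[_ *+ n.+1]mulr_natr -/N.
have -> : rel_ent q m / (2 * N) * N = rel_ent q m / 2 by field; rewrite gt_eqF.
by rewrite ltNge tensorization.
Qed.

Lemma sqrt_telescope (D s : R) : 0 <= s -> s <= D -> D / (2 * N) <= s ->
  N^-1 * Num.sqrt s + Num.sqrt (8 * (D - s) / N) <= Num.sqrt (8 * D / N).
Proof.
move=> s0 sD Ds; have D0 : 0 <= D by exact: le_trans sD.
have N1 : 1 <= N by rewrite ler1n.
set a := Num.sqrt (8 * D / N); set b := Num.sqrt (8 * _ / N); set t := Num.sqrt s.
have a0 : 0 <= a by exact: sqrtr_ge0.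
have b0 : 0 <= b by exact: sqrtr_ge0.
have t0 : 0 <= t by exact: sqrtr_ge0.
have y0 : 0 < N^-1 by rewrite invr_gt0.
have y1 : N^-1 <= 1 by rewrite invf_le1.
set y := N^-1 in y0 y1 *.
have a2 : a ^+ 2 = 8 * D * y by rewrite sqr_sqrtr// divr_ge0 ?(ltW N0)// mulr_ge0.
have t2 : t ^+ 2 = s by rewrite sqr_sqrtr.
have b2 : b ^+ 2 = 8 * (D - s) * y.
  by rewrite sqr_sqrtr// divr_ge0 ?(ltW N0)// mulr_ge0// subr_ge0.
have Dy : D * y <= 2 * s.
  have -> : D * y = 2 * (D / (2 * N)) by rewrite /y; field; rewrite gt_eqF.
  by rewrite ler_pM2l.
(* From [D / N <= 2 s] follows [b ^ 2 <= 16 s - 8 s y <= s (4 - y) ^ 2]. The constant 8 is the one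
   for which [8 * 2] is the square of 4. *)
have bt : b <= t * (4 - y).
  rewrite -(@ler_pXn2r _ 2)// ?nnegrE//; last by rewrite mulr_ge0//; lra.
  rewrite exprMn b2 t2 sqrrB; have := mulr_ge0 s0 (sqr_ge0 y); nra.
have yt0 : 0 <= y * t by rewrite mulr_ge0// ltW.
rewrite -(@ler_pXn2r _ 2)// ?nnegrE ?addr_ge0//.
rewrite sqrrD exprMn a2 b2 t2.
have := ler_wpM2l (mulr_ge0 (ltW y0) t0) bt.
have -> : y * t * (t * (4 - y)) = y * s * (4 - y) by rewrite -t2; ring.
have := mulr_ge0 s0 (sqr_ge0 y); lra.
Qed.

Let lam : R := 1 - (2 * N)^-1.

Let lam0 : 0 <= lam.
Proof.
by rewrite subr_ge0 invf_le1 ?mulr_gt0// mulr_ege1 ?ler1n.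
Qed.

(* Resampling the best coordinate lowers the divergence by [s >= D / (2 N)] and moves
   mass [<= sqrt s] at cost [1 / N]; the costs telescope against [sqrt (8 D / N)]. *)
Lemma coupled_iter k q : prob q -> dominated q m ->
  coupled d q m (Num.sqrt (8 * rel_ent q m / N) + Num.sqrt (lam ^+ k * rel_ent q m)).
Proof.
have [m0 m1] := mP.
elim: k q => [|k IH] q qP qm.
  (* With no step left, the remaining mass moves at distance at most 1; this cost is the second
     square root. *)
  have := coupled_tvar qP mP dxx d1; apply: coupled_le.
  rewrite expr0 !mul1r (le_trans (tvar_le_sqrt_rel_ent qP mP qm))//.
  by rewrite lerDr sqrtr_ge0.
have [q0 q1] := qP; have D0 := rel_ent_ge0 qP mP qm.
have [i Di] := exists_fiber_drop qP qm.
pose q' := resample (g i) q m.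
have q'P : prob q' by exact: prob_resample.
have q'm : dominated q' m by exact: dominated_resample.
have qq' : dominated q q' by exact: dominated_by_resample.
have Eq' : rel_ent q' m = rel_ent q m - fiber_drop (g i) q m.
  by rewrite rel_ent_resample// /fiber_drop opprB addrC subrK.
have Eqq' : rel_ent q q' = fiber_drop (g i) q m by rewrite rel_ent_by_resample.
have s0 : 0 <= fiber_drop (g i) q m by rewrite -Eqq'; exact: rel_ent_ge0.
have sD : fiber_drop (g i) q m <= rel_ent q m.
  by rewrite -subr_ge0 -Eq'; exact: rel_ent_ge0.
have step : coupled d q q' (N^-1 * tvar q q').
  apply: (@coupled_fiber _ _ _ _ (g i)) => //; first by case: q'P.
    by move=> y; rewrite push_resample.
  exact: dg.
apply: coupled_le (coupled_trans dtri step (IH q' q'P q'm)).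
rewrite addrA lerD//.
  rewrite Eq'; apply: le_trans (sqrt_telescope s0 sD Di).
  rewrite lerD2r ler_wpM2l ?invr_ge0 ?(ltW N0)// -Eqq'.
  exact: tvar_le_sqrt_rel_ent.
apply: ler_wsqrtr; rewrite exprSr -mulrA ler_wpM2l ?exprn_ge0//.
by rewrite Eq' /lam mulrBl mul1r lerD2l lerN2 mulrC.
Qed.

(** Finitely many resamplings leave a residual cost [sqrt (lam ^ k D)], which drops below any
    [z > 0]. *)
Lemma tensorization_coupled q (z : R) : prob q -> dominated q m -> 0 < z ->
  coupled d q m (Num.sqrt (8 * rel_ent q m / N) + z).
Proof.
move=> qP qm z0; have D0 := rel_ent_ge0 qP mP qm.
have lam1 : lam < 1.
  by rewrite /lam ltrBlDr ltrDl invr_gt0 mulr_gt0.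
have [k hk] : exists k, lam ^+ k * rel_ent q m <= z ^+ 2.
  have : ((fun k => lam ^+ k * rel_ent q m) @ \oo --> 0 * rel_ent q m)%classic.
    apply: cvgM; last exact: cvg_cst.
    by apply: cvg_expr; rewrite ger0_norm.
  rewrite mul0r => /cvgrPdist_le/(_ (z ^+ 2)); rewrite exprn_gt0// => /(_ isT).
  move=> [k _ /(_ k (leqnn k)) /=]; rewrite sub0r normrN => h; exists k.
  exact: le_trans (ler_norm _) h.
apply: coupled_le (coupled_iter k qP qm).
by rewrite lerD2l -[z in leRHS](gtr0_norm z0) -sqrtr_sqr ler_wsqrtr.
Qed.

End TensorizationTransport.

(** * Minimizers of penalized dual total correlation *)

Section EntropyMinimizer.
Import numFieldNormedType.Exports.
Local Open Scope classical_set_scope.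
Context {R : realType} {X : finType}.

(** On negative reals [ln] is 0. At 0, writing [y = s ^ 2] gives [- y ln y <= 2 s]. *)
Lemma continuous_mul_ln : continuous (fun x : R => x * ln x).
Proof.
move=> x; have [x0|x0|->] := ltgtP x 0.
- rewrite /continuous_at; apply/cvgrPdist_le => /= e e0; near=> y.
  have y0 : y < 0 by near: y; exact: lt_nbhsl.
  by rewrite !ln0 ?(ltW x0) ?(ltW y0)// !mulr0 subrr normr0 ltW.
- apply: cvgM; first exact: cvg_id.
  exact: continuous_ln.
rewrite /continuous_at mul0r; apply/cvgrPdist_le => /= e e0.
near=> y; rewrite sub0r normrN.
have [y0|y0] := leP y 0; first by rewrite ln0// mulr0 normr0 ltW.
have yd : y < Num.min 1 ((e / 2) ^+ 2).
  near: y; apply: lt_nbhsl; rewrite lt_min ltr01 exprn_gt0// divr_gt0//.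
move: yd; rewrite lt_min => /andP[y1 ye].
rewrite ler0_norm; last by rewrite pmulr_rle0// ln_le0// ltW.
set s := Num.sqrt y; have s0 : 0 < s by rewrite sqrtr_gt0.
have ys : y = s ^+ 2 by rewrite sqr_sqrtr// ltW.
have se : s <= e / 2.
  have e20 : 0 <= e / 2 by rewrite divr_ge0// ltW.
  by rewrite -(@ler_pXn2r _ 2)// ?nnegrE ?(ltW s0)// -ys ltW.
have := ln_le_sub1 (_ : 0 < s^-1); rewrite invr_gt0 lnV ?posrE// => /(_ s0) h.
rewrite ys lnXn// -mulr_natr.
have : s ^+ 2 * (- ln s) <= s ^+ 2 * (s^-1 - 1) by rewrite ler_wpM2l// sqr_ge0.
have -> : s ^+ 2 * (s^-1 - 1) = s - s ^+ 2 by field; rewrite gt_eqF.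
have := sqr_ge0 s; lra.
Unshelve. all: by end_near. Qed.

Lemma continuous_sumr (T : topologicalType) (I : Type) (r : seq I) (P : pred I)
    (F : I -> T -> R) :
  (forall i, P i -> continuous (F i)) -> continuous (fun t => \sum_(i <- r | P i) F i t).
Proof.
by move=> Fc; apply: continuous_big => //; exact: add_continuous.
Qed.

(** The extreme value theorem on a compact set: domination by [mu] is built into a box whose sides
    are [{0}] off the support of [mu] and [[0, 1]] on it. *)
Lemma exists_prob_min (G : {ptws X -> R} -> R) (mu : X -> R) :
  prob mu -> continuous G ->
  exists m : X -> R, [/\ prob m, dominated m mu &
    forall q : X -> R, prob q -> dominated q mu -> G m <= G q].
Proof.
move=> muP Gc.
pose B (x : X) : set R := if mu x == 0 then [set 0] else `[0, 1]%classic.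
pose A : set {ptws X -> R} := [set f | forall x, B x (f x)].
pose S : set {ptws X -> R} := [set f | \sum_x f x = 1].
have AS q : prob q -> dominated q mu -> (A `&` S) q.
  move=> [q0 q1] qmu; split=> // x; rewrite /B; case: eqP => [/qmu//|_] /=.
  rewrite in_itv /= q0 -q1 (bigD1 x)//= lerDl; exact: sumr_ge0.
have cA : compact A.
  apply: (@tychonoff X (fun=> R) B) => x; rewrite /B; case: ifP => _.
    exact: compact_set1.
  exact: segment_compact.
have cS : closed S.
  have -> : S = (fun f : {ptws X -> R} => \sum_x f x) @^-1` [set 1] by [].
  apply: preimage_closed; last exact: closed_eq.
  move=> f _; apply: continuous_sumr => x _; exact: (@proj_continuous X (fun=> R) x).
have cAS : compact (A `&` S) by exact: compact_closedI.
have AS0 : (A `&` S) !=set0 by exists mu; apply: AS.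
have Gc' : {within A `&` S, continuous G} by exact: continuous_subspaceT.
have [m /set_mem [mA mS] mmin] := compact_EVT_min AS0 cAS Gc'.
have m0 x : 0 <= m x.
  by have := mA x; rewrite /B; case: ifP => _ /=; [move=> ->|rewrite in_itv /= => /andP[]].
exists m; split=> //.
  by move=> x mux; have := mA x; rewrite /B mux eqxx.
by move=> q qP qmu; apply: mmin; apply/mem_set/AS.
Qed.

End EntropyMinimizer.

Section DualTotalCorrelation.
Import numFieldNormedType.Exports.
Context {R : realType} {X Y : finType} {n : nat}.
Variable g : 'I_n -> X -> Y.
Implicit Types p q m mu : X -> R.

Definition neg_ent {Z : finType} (q : Z -> R) : R := \sum_x q x * ln (q x).

(* When [g i] forgets the i-th coordinate, this is the dual total correlation
   H(xi) - sum_i H(xi_i | xi_j, j != i). *)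
Definition dtc q : R := \sum_i (neg_ent q - neg_ent (push (g i) q)) - neg_ent q.

Lemma neg_entE (Z : finType) (q p : Z -> R) :
  (forall x, 0 <= q x) -> (forall x, 0 <= p x) ->
  dominated q p -> neg_ent q = rel_ent q p + \sum_x q x * ln (p x).
Proof.
move=> q0 p0 qp; rewrite -big_split; apply: eq_bigr => x _ /=.
have [->|qn0] := eqVneq (q x) 0; first by rewrite !mul0r addr0.
have qx : 0 < q x by rewrite lt_def qn0 q0.
have px := gt0_dominated p0 qp qx.
by rewrite ln_div ?posrE// mulrBr subrK.
Qed.

Lemma neg_ent_push (Z W : finType) (f : Z -> W) (q : Z -> R) :
  neg_ent (push f q) = \sum_x q x * ln (push f q (f x)).
Proof. by rewrite /neg_ent (sum_push f q (fun y => ln (push f q y))). Qed.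

Lemma rel_ent_refl (Z : finType) (q : Z -> R) : rel_ent q q = 0.
Proof.
rewrite /rel_ent big1// => x _; have [->|qx] := eqVneq (q x) 0; first by rewrite mul0r.
by rewrite divff// ln1 mulr0.
Qed.

(* Equal to [dtc q + rel_ent q mu / 2] when [q] is dominated by [mu], but continuous
   on the whole simplex. *)
Definition penalized_dtc mu q : R := dtc q + (neg_ent q - \sum_x q x * ln (mu x)) / 2.

Lemma continuous_neg_ent (T : topologicalType) (Z : finType) (F : T -> Z -> R) :
  (forall x, continuous (fun t => F t x)) -> continuous (fun t => neg_ent (F t)).
Proof.
move=> Fc; apply: continuous_sumr => x _ t.
exact: (continuous_comp (Fc x t) (@continuous_mul_ln R (F t x))).
Qed.

Lemma continuous_penalized_dtc mu :
  continuous (penalized_dtc mu : prod_topology (fun _ : X => R) -> R).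
Proof.
have pc x : continuous (fun f : prod_topology (fun _ : X => R) => f x).
  exact: (@proj_continuous X (fun=> R) x).
have nc := continuous_neg_ent pc.
have npc i : continuous
    (fun f : prod_topology (fun _ : X => R) => neg_ent (push (g i) f)).
  by apply: continuous_neg_ent => y; apply: continuous_sumr => x _; exact: pc.
have c1 : continuous (fun f : prod_topology (fun _ : X => R) =>
    \sum_i (neg_ent f - neg_ent (push (g i) f))).
  by apply: continuous_sumr => i _ f; exact: (cvgB (nc f) (npc i f)).
have c2 : continuous (fun f : prod_topology (fun _ : X => R) =>
    \sum_x f x * ln (mu x)).
  by apply: continuous_sumr => x _ f; exact: (cvgM (pc x f) (cvg_cst _)).
move=> f.
exact: (cvgD (cvgB (c1 f) (nc f)) (cvgM (cvgB (nc f) (c2 f)) (cvg_cst _))).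
Qed.

(** The gradient of [penalized_dtc mu] at [m], integrated against [q]; the constant [- 1 / 2] of the
    gradient is dropped since it does not distinguish probability measures. *)
Definition linear_part mu m q : R := \sum_x q x *
  (\sum_i (ln (m x) - ln (push (g i) m (g i x))) - (ln (m x) + ln (mu x)) / 2).

(** An exact expansion at [m]: each entropy splits into a cross term, linear in [q], and a
    divergence. The coefficient of [rel_ent q m] outside the sum is [- 1 + 1 / 2]. *)
Lemma penalized_dtcE mu m q :
  (forall x, 0 <= q x) -> (forall x, 0 <= m x) -> dominated q m ->
  penalized_dtc mu q =
  linear_part mu m q + (\sum_i fiber_drop (g i) q m - rel_ent q m / 2).
Proof.
move=> q0 m0 qm; rewrite /penalized_dtc /dtc /fiber_drop.
rewrite (neg_entE q0 m0 qm).
under eq_bigr => i _.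
  rewrite (neg_entE (push_ge0 (g i) q0) (push_ge0 (g i) m0) (dominated_push m0 qm)).
  rewrite (sum_push (g i) q (fun y => ln (push (g i) m y))).
  over.
have -> : linear_part mu m q =
   \sum_i (\sum_x q x * ln (m x) - \sum_x q x * ln (push (g i) m (g i x)))
   - (\sum_x q x * ln (m x) + \sum_x q x * ln (mu x)) / 2.
  rewrite /linear_part; under eq_bigr do rewrite mulrBr mulr_sumr mulrA mulrDr.
  rewrite sumrB -mulr_suml big_split /= exchange_big /=; congr (_ - _).
  by apply: eq_bigr => i _; rewrite -sumrB; apply: eq_bigr => x _; rewrite mulrBr.
set a := \sum_x q x * ln (m x).
have -> : \sum_(i < n) (rel_ent q m + a - (rel_ent (push (g i) q) (push (g i) m) +
      \sum_x q x * ln (push (g i) m (g i x)))) =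
  \sum_(i < n) (rel_ent q m - rel_ent (push (g i) q) (push (g i) m)) +
  \sum_(i < n) (a - \sum_x q x * ln (push (g i) m (g i x))).
  by rewrite -[RHS]big_split; apply: eq_bigr => i _ /=; lra.
lra.
Qed.

Section Optimality.
Variables (mu m : X -> R).
Hypotheses (mP : prob m) (mmu : dominated m mu).
Hypothesis mmin : forall q, prob q -> dominated q mu ->
  penalized_dtc mu m <= penalized_dtc mu q.

Lemma linear_part_min q : prob q -> dominated q m ->
  linear_part mu m m <=
  linear_part mu m q + (\sum_i fiber_drop (g i) q m - rel_ent q m / 2).
Proof.
move=> qP qm; have [m0 _] := mP; have [q0 _] := qP.
have qmu : dominated q mu by move=> x /mmu /qm.
have := mmin qP qmu; rewrite (penalized_dtcE _ q0 m0 qm).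
rewrite (penalized_dtcE _ m0 m0) /fiber_drop ?rel_ent_refl//.
under eq_bigr do rewrite rel_ent_refl subrr.
by rewrite sumr_const mul0rn mul0r subr0 addr0.
Qed.

(* Moving from [m] slightly away from [q] costs only second order beyond the linear
   part, so the linear part cannot increase towards [q]. *)
Lemma linear_part_le q : prob q -> dominated q m ->
  linear_part mu m q <= linear_part mu m m.
Proof.
move=> qP qm; have [m0 m1] := mP; have [q0 q1] := qP.
(* [q <= C m], so [m - s (q - m)] stays nonnegative for [s <= 1 / C]. *)
pose C := 1 + \sum_x q x / m x.
have qm0 x : 0 <= q x / m x by exact: divr_ge0.
have C1 : 1 <= C by rewrite lerDl sumr_ge0.
have C0 : 0 < C by exact: lt_le_trans C1.
have qC x : q x <= C * m x.
  have [mx|mx] := eqVneq (m x) 0; first by rewrite mx (qm x mx) mulr0.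
  have mx0 : 0 < m x by rewrite lt_def mx m0.
  rewrite -ler_pdivrMr// /C (bigD1 x)//= addrCA lerDl addr_ge0// sumr_ge0//.
pose chi := \sum_x (q x - m x) ^+ 2 / m x.
have chi0 : 0 <= chi by apply: sumr_ge0 => x _; rewrite divr_ge0// sqr_ge0.
(* The second-order loss is [O (s ^ 2)] against a gain linear in [s]; divide by [s] and let it tend
   to 0. *)
suff key s : 0 < s -> s <= C^-1 ->
    linear_part mu m q - linear_part mu m m <= s * (n%:R * chi).
  rewrite -subr_le0; apply/ler_addgt0Pr => e e0; rewrite add0r.
  set K := n%:R * chi; have K0 : 0 <= K by rewrite mulr_ge0.
  pose s := Num.min C^-1 (e / (K + 1)).
  have K1 : 0 < K + 1 by rewrite ltr_wpDl.
  have s0 : 0 < s by rewrite lt_min invr_gt0 C0 divr_gt0.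
  apply: (le_trans (key s s0 _)); first by rewrite ge_min lexx.
  apply: (@le_trans _ _ (e / (K + 1) * K)).
    by rewrite ler_wpM2r// ge_min lexx orbT.
  by rewrite mulrAC ler_pdivrMr// ler_wpM2l ?(ltW e0)// lerDl.
move=> s0 sC; pose p x := m x - s * (q x - m x).
have p0 x : 0 <= p x.
  have : s * q x <= m x.
    apply: (@le_trans _ _ (C^-1 * (C * m x))); last by rewrite mulKf// gt_eqF.
    by apply: ler_pM => //; exact: ltW.
  have := mulr_ge0 (ltW s0) (m0 x); rewrite /p mulrBr; lra.
have pP : prob p.
  by split=> //; rewrite sumrB -mulr_sumr sumrB q1 m1 subrr mulr0 subr0.
have pm : dominated p m.
  by move=> x mx; rewrite /p mx (qm x mx) subrr mulr0 subr0.
have Lp : linear_part mu m p =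
    linear_part mu m m - s * (linear_part mu m q - linear_part mu m m).
  rewrite /linear_part -sumrB mulr_sumr -sumrB; apply: eq_bigr => x _; rewrite /p; ring.
have chip : rel_ent p m <= s ^+ 2 * chi.
  apply: (le_trans (rel_ent_le_chi2 pP mP pm)); rewrite /chi mulr_sumr.
  rewrite le_eqVlt; apply/orP; left; apply/eqP; apply: eq_bigr => x _.
  have -> : p x - m x = - (s * (q x - m x)) by rewrite /p; ring.
  by rewrite sqrrN exprMn -mulrA.
have dropp i : fiber_drop (g i) p m <= s ^+ 2 * chi.
  apply: le_trans chip; rewrite /fiber_drop lerBlDr lerDl.
  apply: rel_ent_ge0; [exact: prob_push|exact: prob_push|exact: dominated_push].
have sdrop : \sum_i fiber_drop (g i) p m <= s ^+ 2 * chi * n%:R.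
  apply: (@le_trans _ _ (\sum_(i < n) s ^+ 2 * chi)); first exact: ler_sum.
  by rewrite sumr_const card_ord mulr_natr.
have := linear_part_min pP pm; have := rel_ent_ge0 pP mP pm; rewrite Lp => h1 h2.
rewrite -(ler_pM2l s0).
have -> : s * (s * (n%:R * chi)) = s ^+ 2 * chi * n%:R by ring.
lra.
Qed.

(** The first-order condition at [m] cancels the linear parts, so minimality says that the
    second-order remainder is nonnegative. *)
Lemma minimizer_tensorization q : prob q -> dominated q m ->
  rel_ent q m / 2 <= \sum_i fiber_drop (g i) q m.
Proof.
move=> qP qm; have := linear_part_min qP qm; have := linear_part_le qP qm; lra.
Qed.

End Optimality.

(** The divergence bound comes from comparing the minimizer with [mu] itself, where the penalty
    vanishes, and from [dtc m >= 0]. *)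
Lemma exists_tensorizing mu : prob mu -> (forall q, prob q -> 0 <= dtc q) ->
  exists m, [/\ prob m, dominated m mu, rel_ent m mu <= 2 * dtc mu &
    forall q, prob q -> dominated q m -> rel_ent q m / 2 <= \sum_i fiber_drop (g i) q m].
Proof.
move=> muP dtc0.
have [m [mP mmu mmin]] := exists_prob_min muP (@continuous_penalized_dtc mu).
exists m; split=> //; last exact: minimizer_tensorization mP mmu mmin.
have [m0 _] := mP; have [mu0 _] := muP.
have mumu : dominated mu mu by [].
have := mmin mu muP mumu; rewrite /penalized_dtc.
rewrite (neg_entE m0 mu0 mmu) (neg_entE mu0 mu0 mumu) rel_ent_refl.
have := dtc0 m mP; lra.
Qed.

End DualTotalCorrelation.

(** * Entropies of subsets of coordinates *)

Section EntropyOfCoordinates.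
Import mathcomp.boot.fintype mathcomp.boot.finset.
Context {R : realType} {A : finType} {n : nat}.
Variable a0 : A.
Let X := {ffun 'I_n -> A}.
Implicit Types (q : X -> R) (T U : {set 'I_n}) (x y : X).

(** Overwriting by [a0] instead of restricting keeps all laws on the same space [X], and erasures
    compose by union. *)
Definition erase T x : X := [ffun j => if j \in T then a0 else x j].

Definition upd (i : 'I_n) (a : A) x : X := [ffun j => if j == i then a else x j].

Lemma erase_comp T U : erase T \o erase U = erase (T :|: U).
Proof.
by apply/funext => x; apply/ffunP => j; rewrite !ffunE inE; do 2!case: (j \in _).
Qed.

Lemma erase_eqP T x y : reflect (forall j, j \notin T -> x j = y j) (erase T x == erase T y).
Proof.
apply: (iffP eqP) => [/ffunP h j jT|h].
  by have := h j; rewrite !ffunE (negPf jT).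
by apply/ffunP => j; rewrite !ffunE; case: ifPn => // /h.
Qed.

(* Minus the Shannon entropy of the coordinates outside [T]. *)
Definition coord_ent q T : R := neg_ent (push (erase T) q).

Lemma push_erase0 q : push (erase set0) q = q.
Proof.
apply/funext => x; rewrite /push (big_pred1 x)// => y.
have E z : erase set0 z = z by apply/ffunP => j; rewrite !ffunE inE.
by rewrite E.
Qed.

Lemma coord_ent0 q : coord_ent q set0 = neg_ent q.
Proof. by rewrite /coord_ent push_erase0. Qed.

Lemma coord_entT q : prob q -> coord_ent q setT = 0.
Proof.
move=> [_ q1]; rewrite /coord_ent neg_ent_push big1// => x _.
rewrite /push (eq_bigl xpredT) ?q1 ?ln1 ?mulr0// => y.
by apply/erase_eqP => j; rewrite inE.
Qed.

Lemma coord_entC1 q i : coord_ent q (~: [set i]) = neg_ent (push (fun x : X => x i) q).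
Proof.
rewrite /coord_ent !neg_ent_push; apply: eq_bigr => x _; congr (_ * ln _).
apply: eq_bigl => y; apply/erase_eqP/eqP => [h|h j].
  by apply: h; rewrite !inE eqxx.
by rewrite !inE negbK => /eqP ->.
Qed.

Definition uniformize i q : X -> R :=
  push (fun ya : X * A => upd i ya.2 ya.1) (fun ya => q ya.1 / #|A|%:R).

Lemma cardA_gt0 : 0 < #|A|%:R :> R.
Proof. by rewrite ltr0n; apply/card_gt0P; exists a0. Qed.

Lemma prob_uniformize i q : prob q -> prob (uniformize i q).
Proof.
move=> [q0 q1]; apply: prob_push; split=> [ya|].
  by rewrite divr_ge0.
rewrite -(pair_bigA _ (fun x (_ : A) => q x / #|A|%:R)) /= -[RHS]q1.
apply: eq_bigr => x _; rewrite sumr_const -[LHS]mulr_natr divfK//.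
by rewrite gt_eqF// cardA_gt0.
Qed.

Lemma push_uniformize q T i x : i \notin T ->
  push (erase T) (uniformize i q) (erase T x) =
  push (erase (i |: T)) q (erase (i |: T) x) / #|A|%:R.
Proof.
move=> iT; rewrite /uniformize push_comp /push.
rewrite -(pair_big_dep xpredT
  (fun y (a : A) => (erase T \o (fun ya : X * A => upd i ya.2 ya.1)) (y, a) == erase T x)
  (fun y (_ : A) => q y / #|A|%:R)) /=.
rewrite mulr_suml [RHS]big_mkcond; apply: eq_bigr => y _.
have E (a : A) : (erase T (upd i a y) == erase T x) =
    (a == x i) && (erase (i |: T) y == erase (i |: T) x).
  apply/erase_eqP/andP => [h|[/eqP ax /erase_eqP h] j jT].
    split; first by have := h _ iT; rewrite ffunE eqxx => ->.
    apply/erase_eqP => j; rewrite !inE negb_or => /andP[ji jT].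
    by have := h j jT; rewrite ffunE (negPf ji).
  rewrite ffunE; case: eqP => [->//|/eqP ji].
  by apply: h; rewrite !inE negb_or ji.
case: ifPn => [h|/negPf h].
  by rewrite (big_pred1 (x i))// => a; rewrite E h andbT.
by rewrite big_pred0// => a; rewrite E h andbF.
Qed.

Lemma dominated_uniformize q i : prob q -> dominated q (uniformize i q).
Proof.
move=> [q0 _] x; rewrite -{1}(push_erase0 (uniformize i q)).
have -> : x = erase set0 x by apply/ffunP => j; rewrite ffunE inE.
rewrite push_uniformize ?inE// => /eqP; rewrite mulf_eq0 invr_eq0.
rewrite (gt_eqF cardA_gt0) orbF => /eqP h; apply/eqP.
rewrite eq_le q0 andbT -{}h.
have -> : erase set0 x = x by apply/ffunP => j; rewrite ffunE inE.
exact: le_push.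
Qed.

(** Both sides are [ln #|A|] minus the entropy of coordinate [i] given the other coordinates outside
    [T]. *)
Lemma rel_ent_uniformize q T i : prob q -> i \notin T ->
  rel_ent (push (erase T) q) (push (erase T) (uniformize i q)) =
  coord_ent q T - coord_ent q (i |: T) + ln #|A|%:R.
Proof.
move=> qP iT; have [q0 q1] := qP.
rewrite /coord_ent !neg_ent_push -sumrB /rel_ent.
rewrite (sum_push (erase T) q
  (fun y => ln (push (erase T) q y / push (erase T) (uniformize i q) y))).
have -> : ln #|A|%:R = \sum_x q x * ln #|A|%:R by rewrite -mulr_suml q1 mul1r.
rewrite -big_split; apply: eq_bigr => x _ /=.
have [->|qn0] := eqVneq (q x) 0; first by rewrite !mul0r subrr addr0.
have qx : 0 < q x by rewrite lt_def qn0 q0.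
have A0 := cardA_gt0.
have P1 := push_gt0 (erase T) q0 qx; have P2 := push_gt0 (erase (i |: T)) q0 qx.
rewrite push_uniformize// ln_div ?posrE ?divr_gt0// ln_div ?posrE//.
by rewrite -mulrBr -mulrDr; congr (_ * _); lra.
Qed.

(* Submodularity, obtained as data processing for the divergence from the measure
   with coordinate [i] made uniform and independent of the rest. *)
Lemma coord_ent_submod q T U i : prob q -> T \subset U -> i \notin U ->
  coord_ent q U - coord_ent q (i |: U) <= coord_ent q T - coord_ent q (i |: T).
Proof.
move=> qP TU iU; have iT : i \notin T by apply: contra iU; exact: (subsetP TU).
rewrite -(lerD2r (ln #|A|%:R)) -!rel_ent_uniformize//.
have -> : erase U = erase U \o erase T by rewrite erase_comp (setUidPl TU).
rewrite -!push_comp; have uP := prob_uniformize i qP; apply: rel_ent_push_le.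
- exact: prob_push.
- exact: prob_push.
- by apply: dominated_push; [case: uP|exact: dominated_uniformize].
Qed.

Lemma set_ind_down (P : {set 'I_n} -> Prop) : P setT ->
  (forall T i, i \notin T -> P (i |: T) -> P T) -> forall T, P T.
Proof.
move=> PT IH T; have [k] := ubnP #|~: T|; elim: k T => // k IHk T.
have [->//|] := eqVneq T setT; rewrite -subTset => /subsetPn[i _ iT] Tk.
apply: (IH T i iT); apply: IHk; rewrite -ltnS; apply: leq_trans Tk.
rewrite ltnS; apply: proper_card; rewrite properE setCS subsetUr /=.
by apply/subsetPn; exists i; rewrite !inE ?eqxx// negbK eqxx.
Qed.

Lemma sum_notin_setU1 (F : 'I_n -> R) T i : i \notin T ->
  \sum_(j | j \notin T) F j = F i + \sum_(j | j \notin i |: T) F j.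
Proof.
move=> iT; rewrite (bigD1 i)//=; congr (_ + _); apply: eq_bigl => j.
by rewrite !inE negb_or andbC.
Qed.

(** Reveal the coordinates one at a time: by submodularity each increment of entropy is at least the
    entropy of that coordinate given all others. *)
Lemma dtc_ge0 q : prob q -> 0 <= dtc (fun i => erase [set i]) q.
Proof.
move=> qP; rewrite /dtc subr_ge0.
have E i : neg_ent q - neg_ent (push (erase [set i]) q) =
    coord_ent q set0 - coord_ent q (i |: set0) by rewrite coord_ent0 setU0.
under eq_bigr do rewrite E.
suff /(_ set0) : forall T, coord_ent q T <=
    \sum_(i | i \notin T) (coord_ent q set0 - coord_ent q (i |: set0)).
  rewrite coord_ent0 => /le_trans; apply; rewrite le_eqVlt; apply/orP; left.
  by apply/eqP; apply: eq_bigl => i; rewrite inE.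
apply: set_ind_down => [|T i iT IH].
  by rewrite coord_entT// sumr_ge0// => i; rewrite inE.
have := coord_ent_submod qP (sub0set T) iT; rewrite (sum_notin_setU1 _ iT); lra.
Qed.

Definition coord_tc q T : R :=
  coord_ent q T - \sum_(i | i \notin T) neg_ent (push (fun x : X => x i) q).

(** The same induction, now bounding each increment above by the unconditional entropy of the
    coordinate. *)
Lemma coord_tc_ge0 q T : prob q -> 0 <= coord_tc q T.
Proof.
move=> qP; move: T; apply: set_ind_down => [|T i iT IH].
  by rewrite /coord_tc coord_entT// big1 ?subr0// => i; rewrite inE.
have TU : T \subset ~: [set i].
  by apply/subsetP => j; rewrite !inE; apply: contraTneq => ->.
have iU : i \notin ~: [set i] by rewrite !inE eqxx.
have := coord_ent_submod qP TU iU.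
rewrite setUCr coord_entT// subr0 coord_entC1.
move: IH; rewrite /coord_tc (sum_notin_setU1 _ iT); lra.
Qed.

Definition tc q : R := neg_ent q - \sum_i neg_ent (push (fun x : X => x i) q).

Lemma coord_tc0 q : coord_tc q set0 = tc q.
Proof.
by rewrite /coord_tc coord_ent0; congr (_ - _); apply: eq_bigl => i; rewrite inE.
Qed.

Lemma tc_ge0 q : prob q -> 0 <= tc q.
Proof. by move=> qP; rewrite -coord_tc0 coord_tc_ge0. Qed.

(** [T] minimizes [coord_tc q T + del #|T|]. Comparison with the empty set bounds [#|T|]; comparison
    with [i |: T] bounds by [del] what coordinate [i] contributes, and [coord_tc q T >= 0] absorbs
    the rest. *)
Lemma exists_small_dtc q (del : R) : prob q -> 0 <= del ->
  exists T, del * #|T|%:R <= tc q /\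
    dtc (fun i => erase [set i]) (push (erase T) q) <= del * n%:R.
Proof.
move=> qP del0; pose phi T := coord_tc q T + del * #|T|%:R.
have [T _ Tmin] : exists2 T, T \in predT & forall U, U \in predT -> phi T <= phi U.
  by case: (@arg_minP _ _ _ set0 predT phi isT) => T ? h; exists T.
have cT := coord_tc_ge0 T qP; exists T; split.
  have := Tmin set0 isT; rewrite /phi cards0 mulr0 addr0 coord_tc0; lra.
rewrite /dtc.
have E i : neg_ent (push (erase T) q) - neg_ent (push (erase [set i]) (push (erase T) q))
    = coord_ent q T - coord_ent q (i |: T).
  by rewrite push_comp erase_comp.
under eq_bigr do rewrite E.
(* Coordinates of [T] are already erased and contribute 0. *)
rewrite (bigID (fun i => i \in T)) /= [X in X + _ - _]big1 ?add0r; last first.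
  by move=> i iT; rewrite (setUidPr _) ?sub1set// subrr.
have drop i : i \notin T -> coord_ent q T - coord_ent q (i |: T) <=
    neg_ent (push (fun x : X => x i) q) + del.
  move=> iT; have := Tmin (i |: T) isT; rewrite /phi /coord_tc cardsU1 iT add1n -natr1 mulrDr mulr1.
  rewrite (sum_notin_setU1 _ iT); lra.
have : \sum_(i | i \notin T) (coord_ent q T - coord_ent q (i |: T)) <=
    \sum_(i | i \notin T) neg_ent (push (fun x : X => x i) q) + del * n%:R.
  apply: (le_trans (ler_sum _ drop)); rewrite big_split /= lerD2l.
  rewrite sumr_const -[leLHS]mulr_natr ler_wpM2l// ler_nat.
  by rewrite -[leqRHS](card_ord n) max_card.
move: cT; rewrite /coord_tc -/(coord_ent q T); lra.
Qed.

End EntropyOfCoordinates.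

(** * Well-concentrated pieces of a measure *)

Section Hamming.
Import mathcomp.boot.fintype mathcomp.boot.finset.
Context {R : realType} {A : finType} {n : nat}.
Variable a0 : A.
Implicit Types x y z : {ffun 'I_n -> A}.

Lemma hammingE x y : hamming R x y = (\sum_i (x i != y i))%N%:R / n%:R.
Proof.
rewrite /hamming -sum1_card big_mkcond /=; congr (_%:R / _); apply: eq_bigr => i _.
rewrite -[X in if X then _ else _]/(`[< x i != y i >]) asboolb.
by case: (x i != y i).
Qed.

Lemma hamming_refl x : hamming R x x = 0.
Proof. by rewrite hammingE big1 ?mul0r// => i _; rewrite eqxx. Qed.

Lemma hamming_sym x y : hamming R x y = hamming R y x.
Proof. by rewrite !hammingE; under eq_bigr do rewrite eq_sym. Qed.

Lemma hamming_le_card (T : {set 'I_n}) x y : (forall i, i \notin T -> x i = y i) ->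
  hamming R x y <= #|T|%:R / n%:R.
Proof.
move=> xy; rewrite hammingE ler_wpM2r ?invr_ge0// ler_nat -sum1_card [leqRHS]big_mkcond.
apply: leq_sum => i _; case: ifPn => [_|/xy ->]; last by rewrite eqxx.
by case: (x i != y i).
Qed.

Lemma hamming_ge0 x y : 0 <= hamming R x y.
Proof. by rewrite hammingE divr_ge0. Qed.

Lemma hamming_le1 x y : hamming R x y <= 1.
Proof.
apply: (le_trans (@hamming_le_card setT x y _)); first by move=> i; rewrite inE.
rewrite cardsT card_ord; have [->|n0] := eqVneq n 0%N; first by rewrite mul0r.
by rewrite divff// pnatr_eq0.
Qed.

Lemma hamming_triangle x y z : hamming R x z <= hamming R x y + hamming R y z.
Proof.
rewrite !hammingE -mulrDl ler_wpM2r ?invr_ge0// -natrD ler_nat -big_split /=.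
apply: leq_sum => i _; have [->|_] := eqVneq (x i) (y i); first by [].
by case: (x i != z i).
Qed.

Lemma hamming_erase (T : {set 'I_n}) x : hamming R x (erase a0 T x) <= #|T|%:R / n%:R.
Proof. by apply: hamming_le_card => i iT; rewrite ffunE (negPf iT). Qed.

Lemma hamming_erase1 i x y : erase a0 [set i] x = erase a0 [set i] y ->
  hamming R x y <= n%:R^-1.
Proof.
move=> /eqP/erase_eqP h.
by have := hamming_le_card h; rewrite cards1 mul1r.
Qed.

End Hamming.

(** * Truncation of a density *)

Section TruncatedMeasure.
Context {R : realType} {X : finType}.
Variables (m p : X -> R) (K del : R).
Hypotheses (mP : prob m) (pP : prob p) (mp : dominated m p).
Hypotheses (del2 : del <= 1 / 2) (K0 : 0 < K).
Hypothesis entK : rel_ent m p + 1 <= K * del.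

Let m1 x : R := if m x <= expR K * p x then m x else 0.
Let Z : R := \sum_x m1 x.

(** Markov's inequality: [ln (m / p) >= K] on the discarded set, while the positive part of this
    logarithm has mean at most [rel_ent m p + 1]. *)
Lemma trunc_mass : 1 - del <= Z <= 1.
Proof.
have [m0 msum] := mP; have [p0 p1] := pP.
apply/andP; split; last first.
  by rewrite -msum; apply: ler_sum => x _; rewrite /m1; case: ifP.
rewrite lerBlDr -lerBlDl -msum -sumrB -(ler_pM2l K0); apply: le_trans entK.
rewrite -[X in _ + X]p1; apply: le_trans (rel_ent_pos_part m0 p0 mp).
rewrite mulr_sumr; apply: ler_sum => x _; rewrite /m1; case: ifPn => [_|].
  by rewrite subrr mulr0 mulr_ge0// le_max lexx.
rewrite -ltNge => h; rewrite subr0 [K * _]mulrC; apply: ler_wpM2l => //.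
have mx : 0 < m x by apply: le_lt_trans h; rewrite mulr_ge0 ?expR_ge0.
have px := gt0_dominated p0 mp mx.
rewrite le_max -[K in K <= ln _]expRK; apply/orP; right.
by rewrite ler_ln ?posrE ?expR_gt0 ?divr_gt0// ler_pdivlMr// ltW.
Qed.

(** [m'] is [m1 / Z], and [Z >= 1 / 2] yields the factor 2. On the support of [m'] one has
    [m = Z m'], so divergences change by [- ln Z <= (1 - Z) / Z <= 2 del]. *)
Lemma exists_trunc : exists m', [/\ prob m',
    forall x, m' x <= 2 * expR K * p x, tvar m m' <= del &
    forall u, prob u -> dominated u m' ->
      dominated u m /\ rel_ent u m <= rel_ent u m' + 2 * del].
Proof.
have [m0 msum] := mP; have [p0 p1] := pP.
have /andP[Zdel Z1] := trunc_mass.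
have Z2 : 1 / 2 <= Z by apply: le_trans Zdel; have := del2; lra.
have Z0 : 0 < Z by apply: lt_le_trans Z2; lra.
have ZV : Z^-1 <= 2 by rewrite invf_ple ?posrE//; lra.
have ZV1 : 1 <= Z^-1 by rewrite invf_ge1.
have m10 x : 0 <= m1 x by rewrite /m1; case: ifP.
have m1m x : m1 x <= m x by rewrite /m1; case: ifP.
pose m' x := m1 x / Z.
have m'0 x : 0 <= m' x by rewrite divr_ge0// ltW.
have m'1 : \sum_x m' x = 1 by rewrite -mulr_suml divff// gt_eqF.
have m1m' x : m1 x <= m' x by rewrite -[leLHS]mulr1 ler_wpM2l.
exists m'; split=> //.
- move=> x; rewrite mulrC (mulrC 2) mulrA.
  apply: ler_pM => //; first by rewrite invr_ge0 ltW.
  by rewrite /m1 mulrC; case: ifP => // _; rewrite mulr_ge0 ?expR_ge0.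
- rewrite /tvar ler_pdivrMr//.
  apply: (@le_trans _ _ (\sum_x ((m x - m1 x) + (m' x - m1 x)))).
    apply: ler_sum => x _; have := m1m x; have := m1m' x.
    by rewrite ler_norml; lra.
  rewrite big_split /= !sumrB msum m'1 -/Z; lra.
move=> u [u0 u1] um'; have um : dominated u m.
  move=> x mx; apply: um'; rewrite /m' (_ : m1 x = 0) ?mul0r//.
  by apply/eqP; rewrite eq_le m10 andbT -mx.
split=> //.
have -> : rel_ent u m = rel_ent u m' - ln Z.
  have -> : ln Z = \sum_x u x * ln Z by rewrite -mulr_suml u1 mul1r.
  rewrite /rel_ent -sumrB; apply: eq_bigr => x _.
  have [->|un0] := eqVneq (u x) 0; first by rewrite !mul0r subrr.
  have ux : 0 < u x by rewrite lt_def un0 u0.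
  have m'x := gt0_dominated m'0 um' ux.
  have mE : m x = m' x * Z.
    move: m'x; rewrite /m' divfK ?gt_eqF// /m1; case: ifP => // _.
    by rewrite mul0r ltxx.
  rewrite mE -mulrBr; congr (_ * _); move: (m' x) m'x => v v0.
  by rewrite !ln_div ?posrE ?mulr_gt0// lnM ?posrE// opprD addrA.
rewrite lerD2l -lnV ?posrE//.
have := ln_le_sub1 (_ : 0 < Z^-1); rewrite invr_gt0 => /(_ Z0) h.
apply: (le_trans h); rewrite -(ler_pM2r Z0) mulrBl mulVf ?gt_eqF// mul1r.
have : 2 * del * (1 / 2) <= 2 * del * Z by rewrite ler_wpM2l//; lra.
lra.
Qed.

End TruncatedMeasure.

(** * Construction of one concentrated piece *)

Section GoodPiece.
Context {R : realType} {A : finType} {k : nat}.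
Let X := {ffun 'I_k.+1 -> A}.
Variables (a0 : A) (r del E : R) (q : X -> R).
Hypotheses (r0 : 0 < r) (del0 : 0 < del) (del2 : del <= 1 / 2) (delr : del <= r / 10).
Hypothesis delr2 : 1200 * (20 * del) <= r ^+ 2.
Hypotheses (qP : prob q) (qE : tc q <= E).

Let N : R := k.+1%:R.
Let kappa : R := r * N / 1200.

Let N1 : 1 <= N. Proof. by rewrite ler1n. Qed.
Let N0 : 0 < N. Proof. by rewrite ltr0n. Qed.

(** Completing the square: [D / kappa = (150 / r) s ^ 2], and [(s - r / 300) ^ 2 >= 0]. *)
Lemma sqrt_le_linear (D : R) : 0 <= D ->
  Num.sqrt (8 * D / N) <= kappa^-1 * D + r / 600.
Proof.
move=> D0; set s := Num.sqrt _.
have s2 : s ^+ 2 = 8 * D / N by rewrite sqr_sqrtr// divr_ge0 ?(ltW N0)// mulr_ge0.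
have -> : kappa^-1 * D = 150 / r * s ^+ 2.
  by rewrite s2 /kappa; field; rewrite !gt_eqF.
have := mulr_ge0 (ltW (divr_gt0 (ltr0n R 150) r0)) (sqr_ge0 (s - r / 300)).
have -> : 150 / r * (s - r / 300) ^+ 2 = 150 / r * s ^+ 2 - s + r / 600.
  by field; rewrite gt_eqF.
lra.
Qed.

(** Transport goes from [nu'] to its erasure [u], to the tensorizing [m], to its truncation [m'],
    and back to [nu]. The additive errors are five terms of at most [r / 10] (two erasures, the
    slack [z], and two effects of truncation) and [r / 600]. *)
Lemma exists_good_piece : exists nu : X -> R, [/\ prob nu,
    forall x, nu x <= 2 * expR ((20 * (E + 1) / r + 1) / del) * q x &
    forall nu', prob nu' -> dominated nu' nu ->
      coupled (@hamming R A k.+1) nu' nu (kappa^-1 * rel_ent nu' nu + r)].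
Proof.
have tc0 : 0 <= tc q by exact: tc_ge0.
have E0 : 0 <= E by exact: le_trans qE.
have E1 : 0 < E + 1 by lra.
(* Chosen so that [eta #|T| <= E] forces [#|T| <= r N / 10]; the price is
   [dtc <= eta N = 10 (E + 1) / r]. Using [E + 1] keeps [eta] positive. *)
pose eta := 10 * (E + 1) / (r * N).
have eta0 : 0 < eta by rewrite divr_gt0 ?mulr_gt0.
have [T [Tcard Tdtc]] := exists_small_dtc a0 qP (ltW eta0).
have TN : #|T|%:R / N <= r / 10.
  rewrite ler_pdivrMr// -(ler_pM2l eta0) (le_trans Tcard)// (le_trans qE)//.
  have -> : eta * (r / 10 * N) = E + 1 by rewrite /eta; field; rewrite !gt_eqF.
  lra.
pose g := erase a0 T; pose qT := push g q.
have qTP : prob qT by exact: prob_push.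
have [m [mP mqT mD mtens]] :=
  exists_tensorizing (g := fun i => erase a0 [set i]%SET) qTP (@dtc_ge0 R A _ a0).
(* [K del] is twice the bound on [dtc], plus the 1 that truncation requires. *)
set K := (20 * (E + 1) / r + 1) / del.
have K0 : 0 < K by rewrite divr_gt0// ltr_wpDl// divr_ge0 ?mulr_ge0 ?(ltW E1) ?(ltW r0).
have mK : rel_ent m qT + 1 <= K * del.
  rewrite divfK ?gt_eqF// lerD2r (le_trans mD)//.
  have -> : 20 * (E + 1) / r = 2 * (eta * N) by rewrite /eta; field; rewrite !gt_eqF.
  by rewrite ler_pM2l.
have [m' [m'P m'K m'tv m'ent]] := exists_trunc mP qTP mqT del2 K0 mK.
have [q0 _] := qP; have [qT0 _] := qTP; have [m'0 m'1] := m'P.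
(* Lifts [m'] from the erased space by the conditional law of [q] given [g]; the density bound is
   inherited. *)
pose nu x := q x * (m' (g x) / qT (g x)).
have nuE : push g nu = m'.
  apply/funext => z; rewrite (push_mulr g q (fun z => m' z / qT z)).
  have [z0|z0] := eqVneq (qT z) 0; last by rewrite mulrC divfK.
  rewrite -/(qT z) z0 mul0r; apply/esym/eqP; rewrite eq_le m'0 andbT.
  by have := m'K z; rewrite z0 mulr0.
have nuP : prob nu.
  split; first by move=> x; rewrite mulr_ge0// divr_ge0.
  by rewrite -(sum_push1 g) nuE.
exists nu; split=> //.
  move=> x; rewrite /nu [q x * _]mulrC ler_wpM2r//.
  have [z0|z0] := eqVneq (qT (g x)) 0.
    by rewrite z0 invr0 mulr0 mulr_ge0// expR_ge0.
  by rewrite ler_pdivrMr ?m'K// lt_def z0 qT0.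
move=> nu' nu'P nu'nu; pose u := push g nu'.
have uP : prob u by exact: prob_push.
have um' : dominated u m' by rewrite -nuE; apply: dominated_push => //; case: nuP.
have [um umD] := m'ent u uP um'.
have uD : rel_ent u m' <= rel_ent nu' nu by rewrite -nuE; exact: rel_ent_push_le.
have hg x : hamming R x (g x) <= r / 10 by apply: le_trans TN; exact: hamming_erase.
have c1 : coupled (@hamming R A k.+1) nu' u (r / 10) by exact: coupled_push.
have c4 : coupled (@hamming R A k.+1) m' nu (r / 10).
  by apply: coupled_sym; [exact: hamming_sym|rewrite -nuE; exact: coupled_push].
have c3 : coupled (@hamming R A k.+1) m m' del.
  apply: coupled_le m'tv _; rewrite -[tvar _ _]mul1r; apply: coupled_tvar => //.
    exact: hamming_refl.
  exact: hamming_le1.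
have r10 : 0 < r / 10 by rewrite divr_gt0.
have c2 : coupled (@hamming R A k.+1) u m (Num.sqrt (8 * rel_ent u m / N) + r / 10).
  apply: (tensorization_coupled _ _ _ _ mP mtens) => //.
  - exact: hamming_refl.
  - exact: hamming_le1.
  - exact: hamming_triangle.
  - by move=> i x y; exact: hamming_erase1.
have tri := @hamming_triangle R A k.+1.
have := coupled_trans tri (coupled_trans tri (coupled_trans tri c1 c2) c3) c4.
apply: coupled_le.
have := sqrt_le_linear (rel_ent_ge0 uP mP um).
have kV0 : 0 < kappa^-1.
  by rewrite invr_gt0; apply: divr_gt0; [exact: mulr_gt0|rewrite ltr0n].
have kdel : kappa^-1 * (2 * del) <= r / 10.
  have -> : kappa^-1 * (2 * del) = 1200 * (20 * del) / (10 * r * N).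
    by rewrite /kappa; field; rewrite !gt_eqF.
  have rN : 0 < 10 * r * N by rewrite !mulr_gt0.
  rewrite ler_pdivrMr//; apply: (le_trans delr2).
  have -> : r / 10 * (10 * r * N) = r ^+ 2 * N by field.
  by rewrite -[leLHS]mulr1 ler_wpM2l// sqr_ge0.
have : kappa^-1 * rel_ent u m <= kappa^-1 * (rel_ent nu' nu + 2 * del).
  by rewrite ler_pM2l// (le_trans umD)// lerD2r.
rewrite mulrDr; have := r0; have := delr; lra.
Qed.

End GoodPiece.

(** * Total correlation under a bounded density *)

Section ProductOfMarginals.
Context {R : realType} {A : finType} {n : nat}.
Let X := {ffun 'I_n -> A}.
Implicit Types q mu theta : X -> R.

Definition marg q i : A -> R := push (fun x : X => x i) q.

Definition prod_marg q (x : X) : R := \prod_i marg q i (x i).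

Lemma prob_prod_marg q : prob q -> prob (prod_marg q).
Proof.
move=> qP; have mP i : prob (marg q i) by exact: prob_push.
split=> [x|]; first by apply: prodr_ge0 => i _; case: (mP i).
by rewrite -(bigA_distr_bigA (marg q)) big1// => i _; case: (mP i).
Qed.

Lemma marg_gt0 q x i : prob q -> 0 < q x -> 0 < marg q i (x i).
Proof. by move=> [q0 _]; exact: push_gt0. Qed.

Lemma prod_marg_gt0 q x : prob q -> 0 < q x -> 0 < prod_marg q x.
Proof. by move=> qP qx; apply: prodr_gt0 => i _; exact: marg_gt0. Qed.

Lemma dominated_prod_marg q : prob q -> dominated q (prod_marg q).
Proof.
move=> qP x px; apply/eqP; apply: contraT => qn0.
have /(prod_marg_gt0 qP) : 0 < q x by have [q0 _] := qP; rewrite lt_def qn0 q0.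
by rewrite px ltxx.
Qed.

Lemma sum_ln_prod_marg q mu : prob q -> prob mu -> dominated q mu ->
  \sum_x q x * ln (prod_marg mu x) = \sum_i \sum_x q x * ln (marg mu i (x i)).
Proof.
move=> [q0 _] muP qmu; have [mu0 _] := muP.
rewrite exchange_big /=; apply: eq_bigr => x _; rewrite -mulr_sumr.
have [->|qn0] := eqVneq (q x) 0; first by rewrite !mul0r.
have mux : 0 < mu x by apply: (gt0_dominated mu0 qmu); rewrite lt_def qn0 q0.
congr (_ * _); rewrite /prod_marg.
suff [] : ln (\prod_i marg mu i (x i)) = \sum_i ln (marg mu i (x i)) /\
  0 < \prod_i marg mu i (x i) by [].
elim/big_rec2: _ => [|i s t _ [<- t0]]; first by rewrite ln1.
have mi := marg_gt0 i muP mux.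
by rewrite lnM ?posrE// mulr_gt0.
Qed.

Lemma tc_rel_ent q : prob q -> rel_ent q (prod_marg q) = tc q.
Proof.
move=> qP; have [q0 _] := qP; have [p0 _] := prob_prod_marg qP.
rewrite /tc (neg_entE q0 p0 (dominated_prod_marg qP)) sum_ln_prod_marg//.
by rewrite [X in _ - X](eq_bigr _ (fun i _ => neg_ent_push _ q)) addrK.
Qed.

(** Replacing the marginals of [q] by those of [mu] adds the divergences between them, which are
    nonnegative. *)
Lemma tc_le_rel_ent q mu : prob q -> prob mu -> dominated q mu ->
  tc q <= rel_ent q (prod_marg mu).
Proof.
move=> qP muP qmu; have [q0 _] := qP; have [mu0 _] := muP.
have [p0 _] := prob_prod_marg muP.
have qp : dominated q (prod_marg mu) by move=> x /(dominated_prod_marg muP) /qmu.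
have := neg_entE q0 p0 qp; rewrite sum_ln_prod_marg// /tc.
suff : \sum_i \sum_x q x * ln (marg mu i (x i)) <=
    \sum_i neg_ent (push (fun x : X => x i) q) by lra.
apply: ler_sum => i _.
rewrite (neg_entE (push_ge0 _ q0) (push_ge0 _ mu0) (dominated_push (g := _) mu0 qmu)).
rewrite (sum_push _ q (fun a => ln (push (fun x : X => x i) mu a))) lerDr.
by apply: rel_ent_ge0; [exact: prob_push|exact: prob_push|exact: dominated_push].
Qed.

(** Bound the divergence of [theta] from the product of the marginals of [mu]. The logarithm is
    replaced by its positive part before [theta <= mu / eps] is applied, since the weight may only
    be enlarged on nonnegative terms. *)
Lemma tc_le_of_density theta mu (eps : R) : prob theta -> prob mu -> 0 < eps ->
  (forall x, theta x <= eps^-1 * mu x) ->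
  tc theta <= ln eps^-1 + (tc mu + 1) / eps.
Proof.
move=> tP muP eps0 tmu; have [t0 t1] := tP; have [mu0 _] := muP.
have [p0 p1] := prob_prod_marg muP.
have eV : 0 < eps^-1 by rewrite invr_gt0.
have dtmu : dominated theta mu.
  by move=> x mux; apply/eqP; rewrite eq_le t0 andbT; have := tmu x; rewrite mux mulr0.
apply: (le_trans (tc_le_rel_ent tP muP dtmu)).
have h := rel_ent_pos_part mu0 p0 (dominated_prod_marg muP).
rewrite tc_rel_ent// p1 in h.
have -> : ln eps^-1 = \sum_x theta x * ln eps^-1 by rewrite -mulr_suml t1 mul1r.
rewrite [_ / eps]mulrC.
apply: le_trans (lerD (lexx _) (ler_wpM2l (ltW eV) h)).
rewrite mulr_sumr -big_split; apply: ler_sum => x _ /=.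
set M := Num.max _ _; have M0 : 0 <= M by rewrite le_max lexx.
have [->|tn0] := eqVneq (theta x) 0.
  by rewrite !mul0r add0r !mulr_ge0// ltW.
have tx : 0 < theta x by rewrite lt_def tn0 t0.
have mux := gt0_dominated mu0 dtmu tx; have px := prod_marg_gt0 muP mux.
apply: (@le_trans _ _ (theta x * (ln eps^-1 + M))).
  apply: ler_wpM2l => //; rewrite -lerBlDl.
  apply: (@le_trans _ _ (ln (mu x / prod_marg mu x))); last by rewrite le_max lexx orbT.
  rewrite lerBlDl -lnM ?posrE ?divr_gt0// ler_ln ?posrE ?mulr_gt0 ?divr_gt0 ?invr_gt0//.
  by rewrite mulrA ler_wpM2r ?invr_ge0.
by rewrite mulrDr lerD2l mulrA ler_wpM2r.
Qed.

End ProductOfMarginals.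

(** * Splitting off pieces *)

Lemma transport_le (R : realType) (X : finType) (d : X -> X -> R)
    (nu mu : {ffun X -> R}) (c : R) :
  (forall x y, 0 <= d x y) -> coupled d nu mu c -> transport d nu mu <= c.
Proof.
move=> d0 [lam [l0 l1 l2 lc]]; apply: le_trans lc; apply: ge_inf.
  by exists 0 => _ [l [[l0' _] ->]]; apply: sumr_ge0 => z _; rewrite mulr_ge0.
exists [ffun z => lam z.1 z.2]; split; first (split; [|split]).
- by move=> z; rewrite ffunE.
- by move=> x; rewrite -l1; apply: eq_bigr => y _; rewrite ffunE.
- by move=> y; rewrite -l2; apply: eq_bigr => x _; rewrite ffunE.
by rewrite pair_bigA; apply: eq_bigr => z _; rewrite ffunE.
Qed.

Lemma Tineq_of_coupled (R : realType) (X : finType) (d : X -> X -> R) (kappa r : R)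
    (mu : {ffun X -> R}) :
  (forall x y, 0 <= d x y) -> 0 < kappa ->
  (forall nu : X -> R, prob nu -> dominated nu mu ->
    coupled d nu mu (kappa^-1 * rel_ent nu mu + r)) ->
  Tineq d kappa r mu.
Proof.
move=> d0 k0 H nu nuP; rewrite /KL; case: ifPn => [/forallP h|_]; last first.
  by rewrite gt0_muley ?lte_fin ?invr_gt0// addye// leey.
have numu : dominated nu mu.
  by move=> x /eqP mux; apply/eqP; have := h x; rewrite mux.
by rewrite -EFinM -EFinD lee_fin; apply: transport_le => //; exact: H.
Qed.

Section Peeling.
Context {R : realType} {X : finType}.
Variables (good : (X -> R) -> Prop) (mu : X -> R) (eps Lam : R).
Hypotheses (eps0 : 0 < eps) (Lam1 : 1 < Lam) (muP : prob mu).
Hypothesis piece : forall theta, prob theta ->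
  (forall x, theta x <= eps^-1 * mu x) ->
  exists nu, [/\ prob nu, forall x, nu x <= Lam * theta x & good nu].

(* While the unprocessed part has mass [w >= eps], a piece of mass [w / Lam] of it
   can be split off. *)
Lemma peel k : exists (w : R) (theta : X -> R) (m : nat) (p : nat -> R)
    (nu : nat -> X -> R),
  [/\ [/\ 0 <= w, prob theta & forall j, (j < m)%N -> [/\ 0 <= p j, prob (nu j) & good (nu j)]],
      w + \sum_(0 <= j < m) p j = 1,
      forall x, mu x = w * theta x + \sum_(0 <= j < m) p j * nu j x,
      (m <= k)%N
    & w < eps \/ w <= 1 - k%:R * (eps / Lam)].
Proof.
have Lam0 : 0 < Lam by exact: lt_trans Lam1.
have LV0 : 0 < Lam^-1 by rewrite invr_gt0.
have LV1 : Lam^-1 < 1 by rewrite invf_lt1.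
elim: k => [|k [w [theta [m [p [nu [[w0 tP pP] wsum muE mk wk]]]]]]].
  exists 1, mu, 0%N, (fun=> 0), (fun=> mu); split=> //.
  - by rewrite big_geq// addr0.
  - by move=> x; rewrite big_geq// addr0 mul1r.
  - by right; rewrite mul0r subr0.
have [weps|weps] := ltP w eps.
  by exists w, theta, m, p, nu; split=> //; [exact: leqW|left].
have wpos : 0 < w by exact: lt_le_trans weps.
have [t0 t1] := tP.
(* The decomposition gives [w theta <= mu], and [w >= eps]. *)
have tmu x : theta x <= eps^-1 * mu x.
  apply: (@le_trans _ _ (w^-1 * mu x)); last first.
    apply: ler_wpM2r; first by case: muP.
    by rewrite lef_pV2 ?posrE.
  rewrite mulrC ler_pdivlMr// mulrC muE lerDl big_nat_cond; apply: sumr_ge0 => j.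
  by rewrite andbT => /= /pP[pj [nj0 _] _]; rewrite mulr_ge0.
have [nu' [nu'P nu'le nu'good]] := piece tP tmu.
have [n0 n1] := nu'P.
have c0 : 0 < 1 - Lam^-1 by rewrite subr_gt0.
have Lm1 : 0 < Lam - 1 by rewrite subr_gt0.
(* [theta - nu' / Lam] is nonnegative because [nu' <= Lam theta], and is renormalized by its mass
   [1 - 1 / Lam], positive since [Lam > 1]. *)
exists (w * (1 - Lam^-1)), (fun x => (theta x - Lam^-1 * nu' x) / (1 - Lam^-1)),
  m.+1, (fun j => if j == m then w / Lam else p j),
  (fun j => if j == m then nu' else nu j).
have pE (F : R -> (X -> R) -> R) : \sum_(0 <= j < m)
    F (if j == m then w / Lam else p j) (if j == m then nu' else nu j) =
    \sum_(0 <= j < m) F (p j) (nu j).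
  by rewrite !big_nat; apply: eq_bigr => j /andP[_ jm]; rewrite ltn_eqF.
split.
- split; first by rewrite mulr_ge0// ltW.
    split=> [x|].
      rewrite divr_ge0 ?(ltW c0)// subr_ge0 -(ler_pM2l Lam0) mulrA divff ?gt_eqF//.
      by rewrite mul1r.
    by rewrite -mulr_suml sumrB -mulr_sumr t1 n1 mulr1 divff// gt_eqF.
  move=> j; rewrite ltnS leq_eqVlt; case: eqP => [_ _|_ /= /pP//].
  by split=> //; rewrite divr_ge0// ltW.
- rewrite big_nat_recr//= eqxx (pE (fun a _ => a)) -[RHS]wsum; ring.
- move=> x; rewrite big_nat_recr//= eqxx (pE (fun a f => a * f x)) muE.
  set S := \sum_(_ <= _ < _) _; field.
  by rewrite !gt_eqF.
- by rewrite ltnS.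
- right; have wk' : w <= 1 - k%:R * (eps / Lam).
    by case: wk => //; rewrite ltNge weps.
  have : eps / Lam <= w / Lam by rewrite ler_pM2r.
  rewrite -natr1 mulrDl mulrBr mulr1; lra.
Qed.

End Peeling.

(** * Dimension zero and the final choice of constants *)

Lemma total_correlationE (R : realType) (A : finType) (n : nat) (mu : {ffun {ffun 'I_n -> A} -> R}) :
  \sum_(i < n) entropy (marginal mu i) - entropy mu = tc mu.
Proof.
rewrite /entropy opprK addrC /tc -sumrN; congr (_ + _); apply: eq_bigr => i _.
by congr (- _); apply: eq_bigr => a _; rewrite ffunE.
Qed.

(** In dimension 0 [A] may be empty, leaving no letter to erase with; instead compare with counting
    measure on the one-point space. *)
Lemma tc_ge0_dim0 (R : realType) (A : finType) (mu : {ffun 'I_0 -> A} -> R) :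
  prob mu -> 0 <= tc mu.
Proof.
move=> [mu0 mu1]; rewrite /tc big_ord0 subr0.
have d1 : dominated mu (fun=> 1 : R) by move=> x /eqP; rewrite oner_eq0.
have := rel_ent_ge mu0 (fun=> ler01) d1.
rewrite mu1 sumr_const card_ffun card_ord expn0 subrr => h; apply: (le_trans h).
by rewrite le_eqVlt; apply/orP; left; apply/eqP; apply: eq_bigr => x _; rewrite divr1.
Qed.

Theorem theoremB (R : realType) (eps r : R) :
  0 < eps -> 0 < r ->
  exists c : R, 0 < c /\
    forall (A : finType) (n : nat) (mu : {ffun {ffun 'I_n -> A} -> R}),
      is_prob mu ->
      let E := \sum_(i < n) entropy (marginal mu i) - entropy mu in
      exists (m : nat) (p : nat -> R) (mus : nat -> {ffun {ffun 'I_n -> A} -> R}),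
        [/\ (forall j, (1 <= j <= m)%N -> 0 <= p j /\ is_prob (mus j)),
            \sum_(1 <= j < m.+1) p j = 1 /\
            (forall x, mu x = \sum_(1 <= j < m.+1) p j * mus j x),
            m%:R <= c * expR (c * E),
            p 1%N < eps
          & forall j, (2 <= j <= m)%N ->
              Tineq (@hamming R A n) (r * n%:R / 1200) r (mus j)].
Proof.
move=> eps0 r0.
(* The cap at 1/2 makes [ln e^-1] nonnegative. *)
pose e := Num.min eps (1 / 2).
have e0 : 0 < e by rewrite lt_min eps0; lra.
have ee : e <= eps by rewrite ge_min lexx.
have e2 : e <= 1 / 2 by rewrite ge_min lexx orbT.
pose del := Num.min (1 / 2) (Num.min (r / 10) (r ^+ 2 / 1200 / 20)).
have r20 : 0 < r ^+ 2 by rewrite exprn_gt0.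
have c0 : 0 < 1200 :> R by rewrite ltr0n.
have del0 : 0 < del.
  rewrite !lt_min; apply/and3P; split; [lra|lra|].
  by apply: divr_gt0; [exact: divr_gt0|lra].
have del2 : del <= 1 / 2 by rewrite ge_min lexx.
have delr : del <= r / 10 by rewrite !ge_min lexx !orbT.
have delr2 : 1200 * (20 * del) <= r ^+ 2.
  have : del <= r ^+ 2 / 1200 / 20 by rewrite !ge_min lexx !orbT.
  by rewrite mulrA ler_pdivlMr// ler_pdivlMr//; move: c0 => _; set c := 1200; lra.
(* The exponent of [exists_good_piece] with the bound of [tc_le_of_density] for [tc theta] inserted;
   it is affine in [E]. *)
pose K (E : R) := (20 * (ln e^-1 + (E + 1) / e + 1) / r + 1) / del.
pose al := 20 / (e * r * del).
have KE E : K E = al * E + K 0.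
  by rewrite /K /al; field; rewrite !gt_eqF.
have al0 : 0 < al by rewrite divr_gt0// !mulr_gt0.
have lne : 0 <= ln e^-1 by rewrite ln_ge0// invf_ge1//; lra.
have K00 E : 0 <= E -> 0 < K E.
  move=> E0; rewrite divr_gt0// ltr_wpDl// divr_ge0 ?(ltW r0)// mulr_ge0//.
  by rewrite !addr_ge0// divr_ge0 ?(ltW e0)// addr_ge0.
(* The number of pieces will be at most [Lam / e + 2], with [Lam = 2 expR (K E)]. *)
pose C := 2 * expR (K 0) / e + 2.
have C0 : 0 < C by rewrite ltr_wpDl// divr_ge0 ?(ltW e0)// mulr_ge0// expR_ge0.
exists (C + al); split; first exact: addr_gt0.
move=> A n mu muP; rewrite total_correlationE => E.
have CE : 0 <= E -> C * expR (al * E) <= (C + al) * expR ((C + al) * E).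
  move=> E0; apply: ler_pM; rewrite ?expR_ge0 ?(ltW C0)//.
    by rewrite lerDl ltW.
  by rewrite ler_expR ler_wpM2r// lerDr ltW.
case: n mu muP @E CE => [|k] mu muP E CE.
  have E0 : 0 <= E by exact: tc_ge0_dim0.
  (* Here [kappa = 0], whose inverse is 0, and [0 * +oo = 0]: the inequality reduces to a transport
     cost at most [r], and the Hamming cost is 0. *)
  exists 2%N, (fun j => if j == 1%N then 0 else 1), (fun=> mu); split.
  - by move=> j _; split=> //; case: ifP.
  - split=> [|x]; rewrite big_ltn// big_nat1 /= ?add0r//.
    by rewrite mul0r mul1r add0r.
  - apply: le_trans (CE E0); apply: (@le_trans _ _ C).
      by rewrite lerDr divr_ge0 ?(ltW e0)// mulr_ge0// expR_ge0.
    rewrite -[leLHS]mulr1; apply: ler_wpM2l; first exact: ltW.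
    by rewrite -expR0 ler_expR mulr_ge0// ltW.
  - by rewrite eqxx.
  move=> j _ nu nuP; rewrite mulr0 mul0r invr0 mul0e add0e lee_fin.
  apply: (@le_trans _ _ 0); last exact: ltW.
  apply: transport_le; first exact: hamming_ge0.
  rewrite -[0](mul0r (tvar nu mu)); apply: coupled_tvar => //.
    exact: hamming_refl.
  by move=> x y; rewrite hammingE big_ord0 mul0r.
have muP' : prob mu := muP.
have [x0 _] : exists x, mu x != 0.
  apply: contrapT => /forallNP h; have [_] := muP; rewrite big1 => [/eqP|x _].
    by rewrite eq_sym oner_eq0.
  by apply/eqP; have /negP := h x; rewrite negbK.
have E0 : 0 <= E by exact: (tc_ge0 (x0 ord0) muP').
set Lam := 2 * expR (K E).
have Lam1 : 1 < Lam.
  have : 1 < expR (K E) by rewrite expR_gt1 K00.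
  rewrite /Lam; lra.
have Lam0 : 0 < Lam by exact: lt_trans Lam1.
pose kappa : R := r * k.+1%:R / 1200.
have kappa0 : 0 < kappa by apply: divr_gt0 => //; exact: mulr_gt0.
pose good (nu : {ffun 'I_k.+1 -> A} -> R) := forall nu', prob nu' -> dominated nu' nu ->
  coupled (@hamming R A k.+1) nu' nu (kappa^-1 * rel_ent nu' nu + r).
have piece theta : prob theta -> (forall x, theta x <= e^-1 * mu x) ->
    exists nu, [/\ prob nu, forall x, nu x <= Lam * theta x & good nu].
  move=> tP tmu; have tE := tc_le_of_density tP muP' e0 tmu.
  have [nu [nuP nule nug]] :=
    exists_good_piece (x0 ord0) r0 del0 del2 delr delr2 tP tE.
  by exists nu; split.
(* [N > Lam / e], so after [N] rounds the linear bound on [w] is already nonpositive and [w < e]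
   holds in both cases. *)
pose N := (Num.truncn (Lam / e)).+1.
have /andP[N1 N2] := truncn_itv (ltW (divr_gt0 Lam0 e0)).
have [w [theta [m [p [nu [[w0 tP pP] wsum muE mN wN]]]]]] :=
  peel e0 Lam1 muP' piece N.
have we : w < e.
  case: wN => // /le_lt_trans; apply; apply: (le_lt_trans _ e0).
  rewrite subr_le0 mulrA ler_pdivlMr// mul1r -(ler_pdivrMr _ _ e0); exact: ltW N2.
(* Index 1 holds the leftover; the pieces, counted from 0, start at index 2. *)
exists m.+1, (fun j => if j == 1%N then w else p (j - 2)%N),
  (fun j => if j == 1%N then finfun theta else finfun (nu (j - 2)%N)).
have fP (f : {ffun 'I_k.+1 -> A} -> R) : prob f -> is_prob (finfun f).
  move=> [f0 f1]; split=> [x|]; first by rewrite ffunE.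
  by under eq_bigr do rewrite ffunE.
split.
- move=> [|[|j]]//= jm; first by split=> //; exact: fP.
  rewrite subn2 /=; have [|pj nj _] := pP j; first by rewrite !ltnS in jm.
  by split=> //; exact: fP.
- have shift (F : nat -> R) :
      \sum_(1 <= j < m.+2) F j = F 1%N + \sum_(0 <= j < m) F j.+2.
    by rewrite big_ltn// !big_add1.
  rewrite shift /=; split=> [|x]; last rewrite shift /= muE ffunE.
    by rewrite -[RHS]wsum; congr (_ + _); apply: eq_bigr => j _; rewrite subn2.
  by congr (_ + _); apply: eq_bigr => j _; rewrite subn2 ffunE.
- apply: le_trans (CE E0); apply: (@le_trans _ _ (Lam / e + 2)).
    have : m.+1%:R <= N.+1%:R :> R by rewrite ler_nat ltnS.
    rewrite -(natr1 N) -(natr1 (Num.truncn _)); lra.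
  rewrite /Lam (KE E) expRD /C [leRHS]mulrDl; apply: lerD.
    by rewrite le_eqVlt; apply/orP; left; apply/eqP; ring.
  rewrite -[leLHS]mulr1 ler_wpM2l// -expR0 ler_expR mulr_ge0//; exact: ltW.
- exact: lt_le_trans ee.
move=> [|[|j]]//= jm; rewrite subn2 /=; have [|pj nj gj] := pP j; first by rewrite !ltnS in jm.
apply: Tineq_of_coupled => //; first exact: hamming_ge0.
have -> : (finfun (nu j) : _ -> R) = nu j by apply/funext => x; rewrite ffunE.
exact: gj.
Qed.
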